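(* Let $G$ be a co-edge-regular graph with parameters $(n,k,2)$ having exactly four distinct eigenvalues $k=\theta_0>\theta_1>\theta_2>\theta_3$. Put $$\ell:=2\Big(\sum_{i=1}^{3}\theta_i\Big)+\frac{\prod_{i=1}^{3}(k-\theta_i)}{n}-2(k-2).$$ (i) If $\ell\geqslant \frac{3}{4}k$, then either $G$ is a $p\times q$-grid with $p>q\geqslant 2$, $p+q=k+2$ and $\ell=k-2$, or $G$ is the $2$-clique extension of the pentagon $C_5$. (ii) If $\theta_3\geqslant -3$ and $k\geqslant 120$, then $G$ is a $p\times q$-grid with $p>q\geqslant 2$, $p+q=k+2$ and $\ell=k-2$.
   Context: All graphs are finite, undirected and simple; eigenvalues of a graph are those of its adjacency matrix. A co-edge-regular graph with parameters $(n,k,c)$ is a $k$-regular graph on $n$ vertices, neither complete nor edgeless, in which any two distinct non-adjacent vertices have exactly $c$ common neighbours. The $p\times q$-grid is the Cartesian product $K_p\,\square\,K_q$ (equivalently the line graph of $K_{p,q}$). For a positive integer $s$, the $s$-clique extension of a graph $H$ is obtained by replacing each vertex $x$ of $H$ by a clique $\tilde X$ of $s$ vertices, where $\tilde x\in\tilde X$ and $\tilde y\in\tilde Y$ (for distinct cliques) are adjacent iff $x\sim y$ in $H$ (vertices in the same clique are adjacent). *)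

(* Defs.v *)
From HB Require Import structures.
From mathcomp Require Import all_boot all_order all_algebra.

Set Implicit Arguments.
Unset Strict Implicit.
Unset Printing Implicit Defensive.

Import Order.TTheory GRing.Theory Num.Theory.

Record sgraph := SGraph {
  vertex :> finType;
  adj : rel vertex;
  adj_sym : symmetric adj;
  adj_irrefl : irreflexive adj }.

Definition isomorphic (G H : sgraph) : Prop :=
  exists2 f : G -> H, bijective f & {mono f : x y / adj x y}.

Definition is_complete (G : sgraph) : Prop :=
  forall x y : G, x != y -> adj x y.

Definition is_edgeless (G : sgraph) : Prop :=
  forall x y : G, ~~ adj x y.

Definition regular (G : sgraph) (k : nat) : Prop :=
  forall x : G, #|[set y | adj x y]| = k.

Definition co_edge_regular (G : sgraph) (n k c : nat) : Prop :=
  [/\ #|G| = n,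
      regular G k,
      ~ is_complete G,
      ~ is_edgeless G &
      forall x y : G, x != y -> ~~ adj x y ->
        #|[set z | adj x z && adj y z]| = c].

Definition adjmx (R : nzRingType) (G : sgraph) : 'M[R]_#|G| :=
  \matrix_(i, j) (adj (enum_val i) (enum_val j))%:R%R.

Section Complete.
Variable n : nat.
Definition complete_adj : rel 'I_n := fun i j => i != j.
Lemma complete_adj_sym : symmetric complete_adj.
Proof. by move=> i j; rewrite /complete_adj eq_sym. Qed.
Lemma complete_adj_irrefl : irreflexive complete_adj.
Proof. by move=> i; rewrite /complete_adj eqxx. Qed.
Definition complete_graph : sgraph :=
  SGraph complete_adj_sym complete_adj_irrefl.
End Complete.

(* ordS is the cyclic successor on 'I_n; the conjunct i != j only matters for  *)
(* n = 1, where it removes the loop.                                          *)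
Section Cycle.
Variable n : nat.
Definition cycle_adj : rel 'I_n :=
  fun i j => (i != j) && ((ordS i == j) || (ordS j == i)).
Lemma cycle_adj_sym : symmetric cycle_adj.
Proof. by move=> i j; rewrite /cycle_adj eq_sym orbC. Qed.
Lemma cycle_adj_irrefl : irreflexive cycle_adj.
Proof. by move=> i; rewrite /cycle_adj eqxx. Qed.
Definition cycle_graph : sgraph := SGraph cycle_adj_sym cycle_adj_irrefl.
End Cycle.

Section CartesianProduct.
Variables G H : sgraph.
Definition cart_adj : rel (G * H) := fun u v =>
  ((u.1 == v.1) && adj u.2 v.2) || ((u.2 == v.2) && adj u.1 v.1).
Lemma cart_adj_sym : symmetric cart_adj.
Proof.
move=> u v; rewrite /cart_adj (eq_sym v.1) (eq_sym v.2).
by rewrite (adj_sym v.1) (adj_sym v.2).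
Qed.
Lemma cart_adj_irrefl : irreflexive cart_adj.
Proof. by move=> u; rewrite /cart_adj !adj_irrefl !andbF. Qed.
Definition cartesian_product : sgraph := SGraph cart_adj_sym cart_adj_irrefl.
End CartesianProduct.

Definition grid (p q : nat) : sgraph :=
  cartesian_product (complete_graph p) (complete_graph q).

(* The pair (x, i) is the i-th vertex of the clique that replaces x. *)
Section CliqueExtension.
Variables (s : nat) (H : sgraph).
Definition clique_ext_adj : rel (H * 'I_s) := fun u v =>
  (u != v) && ((u.1 == v.1) || adj u.1 v.1).
Lemma clique_ext_adj_sym : symmetric clique_ext_adj.
Proof.
by move=> u v; rewrite /clique_ext_adj eq_sym (eq_sym v.1) (adj_sym v.1).
Qed.
Lemma clique_ext_adj_irrefl : irreflexive clique_ext_adj.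
Proof. by move=> u; rewrite /clique_ext_adj eqxx. Qed.
Definition clique_extension : sgraph :=
  SGraph clique_ext_adj_sym clique_ext_adj_irrefl.
End CliqueExtension.

(* Main.v *)
(** Write lam(x, y) for the number of common neighbours of x and y.  The graph
    has diameter 2, so the four-eigenvalue condition says that
    (A - t1)(A - t2)(A - t3) is a multiple of J.  Its entry at non-adjacent x, y
    with common neighbours u, v reads lam(y, u) + lam(y, v) = l: on edges, the
    values of lam come in pairs with sum l.

    Since c = 2, adjacency is an equivalence relation on the common neighbours
    of two adjacent vertices.  Let a be the largest value of lam on edges.

    If two vertices x, u are twins (lam(x, u) = k - 1), then all other edges at
    x have lam = l / 2, every vertex has exactly one twin, and looking for
    independent sets in neighbourhoods leaves only the 2-clique extension of
    the pentagon.

    Without twins, a <= l / 2 would make lam constant on edges, so G would be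
    strongly regular with only three eigenvalues.  If a > l / 2, put
    b = l - a < a; counting the vertices attached to the common neighbours of
    an edge with lam = a shows that these neighbours form a clique.  This uses
    l >= 3k/4 in (i), and in (ii) the bound a >= k/3 - 3, which is the
    inequality A + 3I >= 0 tested on the vector equal to 3 on the neighbourhood
    of x and to -k at x.  Then the neighbourhood of each vertex is a union of
    two disjoint cliques of sizes a + 1 and b + 1, and G is the
    (a + 2) x (b + 2)-grid. *)

Require Import Defs.
From HB Require Import structures.
From mathcomp Require Import all_boot all_order all_algebra.
From mathcomp Require Import spectral complex zify ring lra.

Set Implicit Arguments.
Unset Strict Implicit.
Unset Printing Implicit Defensive.

Import Order.TTheory GRing.Theory Num.Theory.

(** * Arithmetic for split edges, the pentagon, and grids from two partitions *)

(** The hypotheses are those supplied by [split_edge_bounds]. The sum of the two bounds contains (m1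
    + m2)(a - b), which is quadratic in a, while 2k <= 8L/3 is linear; only the smallest parameters
    survive. *)
Lemma split_bounds_large_sum k L a b m1 m2 : a + b = L -> b < a -> 0 < b ->
  m1 * (a - b) + a < k -> m2 * (a - b) + a < k -> 3 * k <= 4 * L ->
  (2 * b <= a /\ a = m1 + m2) \/
    (b <= m1 + m2 /\ exists2 h, 2 * h = L & a = h + (m1 + m2)) ->
  [/\ a = 2, L = 3 & k = 4].
Proof.
move=> abL ltba b0; set t := a - b; have ta : a = b + t by lia.
move=> b1 b2 kL; have sum : (m1 + m2) * t + 2 * a + 2 <= 2 * k by lia.
case=> [[ab am]|[bm [h hL ah]]].
  rewrite -am in sum; have t2 : a <= 2 * t by lia.
  (* Since L <= 3a/2, the sum of the bounds gives at + 2 <= 2a; with a <= 2t this yields (a - 2)^2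
     <= 0. *)
  have q : a * a <= 2 * (a * t) by nia.
  have a2 : a = 2 by nia.
  have t1 : t = 1 by rewrite a2 in sum; lia.
  by split; lia.
have tm : t = 2 * (m1 + m2) by lia.
move: tm sum bm; set m := m1 + m2 => tm sum bm.
have m1E : m = 1 by nia.
(* Here b = 1, a = 3 and L = 4, so 3k <= 16, whereas the one of [m1], [m2] equal to 1 gives k >
   5. *)
by exfalso; have := b1; have := b2; rewrite tm; nia.
Qed.

(** Here a >= 37. In the first case the sum of the bounds gives a^2 <= 8a + 32; in the second, with
    m = m1 + m2 and a <= 3m, it gives m^2 <= 6m + 8. Both keep a below 37. *)
Lemma split_bounds_large_valency k L a b m1 m2 : a + b = L -> b < a ->
  m1 * (a - b) + a < k -> m2 * (a - b) + a < k -> 120 <= k -> k <= 3 * a + 9 ->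
  (2 * b <= a /\ a = m1 + m2) \/
    (b <= m1 + m2 /\ exists2 h, 2 * h = L & a = h + (m1 + m2)) ->
  False.
Proof.
move=> abL ltba; set t := a - b; have ta : a = b + t by lia.
move=> b1 b2 k120 ka; have sum : (m1 + m2) * t + 2 * a + 2 <= 2 * k by lia.
case=> [[ab am]|[bm [h hL ah]]].
  rewrite -am in sum; have t2 : a <= 2 * t by lia.
  have q : a * a <= 2 * (a * t) by nia.
  by nia.
have tm : t = 2 * (m1 + m2) by lia.
move: tm sum bm; set m := m1 + m2 => tm sum bm.
by nia.
Qed.

(** The vertex m tells i and j apart, so a copy of the pentagon inside a graph contains no twins. *)
Lemma pentagon_separated (i j : 'I_5) : i != j ->
  exists m : 'I_5, [&& cycle_adj i m, ~~ cycle_adj j m & m != j].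
Proof.
case: i j => [[|[|[|[|[|//]]]]] hi] [[|[|[|[|[|//]]]]] hj] //= _;
  by [exists (ordS (Ordinal hi)) | exists (ord_pred (Ordinal hi))].
Qed.

Lemma pairwise_sym_in (T : eqType) (r : rel T) (s : seq T) : symmetric r ->
  pairwise r s -> {in s &, forall x y, x != y -> r x y}.
Proof.
move=> sym; elim: s => //= z s IH /andP[/allP zs /IH{}IH] x y.
rewrite !inE => /predU1P[->|xs] /predU1P[->|ys]; rewrite ?eqxx // => xy.
- exact: zs.
- by rewrite sym zs.
- exact: IH.
Qed.

(** A class of [EA] and a class of [EB] meet in exactly one vertex, so a vertex is determined by its
    two classes, which serve as grid coordinates. *)
Lemma grid_of_equivalences (G : sgraph) (EA EB : rel G) (x0 : G) :
  equivalence_rel EA -> equivalence_rel EB ->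
  (forall x y, EA x y -> EB x y -> x = y) ->
  (forall x y, exists z, EA x z && EB z y) ->
  (forall x y, adj x y = (x != y) && (EA x y || EB x y)) ->
  isomorphic G (grid #|[set y | EA x0 y]| #|[set y | EB x0 y]|).
Proof.
move=> /equivalence_relP[rA tA] /equivalence_relP[rB tB] cap tot adjE.
have sA x y : EA x y = EA y x.
  by apply/idP/idP => h; [rewrite -(tA _ _ h)|rewrite -(tA _ _ h)]; apply: rA.
have sB x y : EB x y = EB y x.
  by apply/idP/idP => h; [rewrite -(tB _ _ h)|rewrite -(tB _ _ h)]; apply: rB.
pose p x y := xchoose (tot x y).
have pA x y : EA x (p x y) by have /andP[] := xchooseP (tot x y).
have pB x y : EB (p x y) y by have /andP[] := xchooseP (tot x y).
have pU x y z : EA x z -> EB z y -> p x y = z.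
  move=> xz zy; apply: cap.
    by rewrite -(tA _ _ (pA x y)).
  by rewrite (tB _ _ (pB x y)) sB.
have x0P : x0 \in [set y | EA x0 y] by rewrite inE rA.
have x0Q : x0 \in [set y | EB x0 y] by rewrite inE rB.
(* The coordinates of [y] are the point where its [EB]-class meets the [EA]-class of [x0], and the
   point where its [EA]-class meets the [EB]-class of [x0]. *)
pose f y : grid #|[set y | EA x0 y]| #|[set y | EB x0 y]| :=
  (enum_rank_in x0P (p x0 y), enum_rank_in x0Q (p y x0)).
have pP y : p x0 y \in [set y | EA x0 y] by rewrite inE.
have pQ y : p y x0 \in [set y | EB x0 y] by rewrite inE sB.
exists f.
  pose g (ij : grid #|[set y | EA x0 y]| #|[set y | EB x0 y]|) :=
    p (enum_val ij.2) (enum_val ij.1).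
  exists g => [y|[i j]].
    by rewrite /g /f /= !enum_rankK_in //; apply: pU; rewrite 1?sA // sB.
  have := enum_valP i; have := enum_valP j; rewrite !inE => jQ iP.
  rewrite /f /g /=; set w := enum_val j in jQ *; set z := enum_val i in iP *.
  rewrite (pU x0 (p w z) z) //; last by rewrite sB.
  rewrite (pU (p w z) x0 w); [|by rewrite sA|by rewrite sB].
  by rewrite !enum_valK_in.
have eB x y : (p x0 x == p x0 y) = EB x y.
  apply/eqP/idP => [e|xy]; last by apply: pU => //; rewrite (tB _ _ (pB x0 y)) sB.
  by rewrite -(tB _ _ (pB x0 x)) e.
have eA x y : (p x x0 == p y x0) = EA x y.
  apply/eqP/idP => [e|xy]; last by apply: pU => //; rewrite (tA _ _ xy).
  by rewrite (tA _ _ (pA x x0)) e sA.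
have rk (A : {set G}) (h : x0 \in A) x y : x \in A -> y \in A ->
    (enum_rank_in h x == enum_rank_in h y) = (x == y).
  move=> xA yA; apply/eqP/eqP => [e|-> //].
  by rewrite -(enum_rankK_in h xA) e enum_rankK_in.
move=> x y; rewrite adjE /= /cart_adj /= /complete_adj !rk // eA eB.
have [-> | ne] := eqVneq x y; first by rewrite rA rB.
by case hA: (EA x y); case hB: (EB x y) => //; rewrite (cap x y hA hB) eqxx in ne.
Qed.

(** * Common neighbours in graphs with c = 2 *)

Section LocalStructure.
Variable G : sgraph.
Implicit Types x y z u v w c d e : G.

Definition nbr x : {set G} := [set y | adj x y].
Definition cnbr x y : {set G} := [set z | adj x z && adj y z].
Definition lam x y := #|cnbr x y|.

Lemma in_nbr x y : (y \in nbr x) = adj x y. Proof. by rewrite inE. Qed.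

Lemma in_cnbr x y z : (z \in cnbr x y) = adj x z && adj y z.
Proof. by rewrite inE. Qed.

Lemma cnbrC x y : cnbr x y = cnbr y x.
Proof. by apply/setP => z; rewrite !inE andbC. Qed.

Lemma lamC x y : lam x y = lam y x. Proof. by rewrite /lam cnbrC. Qed.

Lemma adj_neq x y : adj x y -> x != y.
Proof. by apply: contraTneq => ->; rewrite adj_irrefl. Qed.

Lemma adj_nadj_neq x y z : adj x z -> ~~ adj y z -> x != y.
Proof. by move=> xz; apply: contraNneq => <-. Qed.

Ltac adj_done := first [assumption | rewrite adj_sym; assumption].
Ltac neq_done := first [assumption | rewrite eq_sym; assumption
  | apply: adj_neq; adj_done
  | match goal with |- is_true (?x != ?y) => match goal with
    | H : is_true (adj x ?z) |- _ => apply: (@adj_nadj_neq x y z); adj_done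
    | H : is_true (adj ?z x) |- _ => apply: (@adj_nadj_neq x y z); adj_done
    | H : is_true (adj y ?z) |- _ =>
        rewrite eq_sym; apply: (@adj_nadj_neq y x z); adj_done
    | H : is_true (adj ?z y) |- _ =>
        rewrite eq_sym; apply: (@adj_nadj_neq y x z); adj_done
    end end].
Ltac gr := solve [adj_done | neq_done | done].

(* [far x u] is the part of the neighbourhood of x outside the closed
   neighbourhood of u; [cls x u c] is the clique containing c among the common
   neighbours of x and u, see [diamond]. *)
Definition far x u : {set G} := [set d | [&& adj x d, ~~ adj u d & d != u]].
Definition cls x u c : {set G} := [set z in cnbr x u | (z == c) || adj c z].
Definition att x u c : {set G} := [set d in far x u | adj c d].

Lemma in_far x u d : (d \in far x u) = [&& adj x d, ~~ adj u d & d != u].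
Proof. by rewrite inE. Qed.

Lemma clsC x u c : cls x u c = cls u x c.
Proof. by rewrite /cls cnbrC. Qed.

(** A common neighbour of [x] and [c] is [u], or another member of the clique of [c], or attached to
    [c]; the vertex [u] is counted by [c] itself, which belongs to [cls x u c]. *)
Lemma lam_split x u c : adj x u -> c \in cnbr x u ->
  lam x c = #|cls x u c| + #|att x u c|.
Proof.
move=> xu; rewrite in_cnbr => /andP[xc uc].
have cC : c \in cls x u c by rewrite !inE xc uc eqxx.
have uC : u \in cnbr x c by rewrite in_cnbr xu adj_sym uc.
rewrite /lam (cardsD1 u) uC (cardsD1 c (cls x u c)) cC -addnA; congr (_ + _).
rewrite -cardsUI [X in _ = _ + X](_ : _ = 0); last first.
  apply/eqP; rewrite cards_eq0; apply/eqP/setP => z; rewrite !inE.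
  by case: (adj u z); rewrite /= ?andbF.
rewrite addn0; apply: eq_card => z; rewrite !inE.
case: (eqVneq z c) => [->|zc] /=; first by rewrite uc !adj_irrefl !andbF.
case: (eqVneq z u) => [->|zu] /=; first by rewrite adj_irrefl !andbF.
by case: (adj x z); case: (adj u z); case: (adj c z).
Qed.

Variable k : nat.
Hypothesis regG : regular G k.

Lemma far_card x u : adj x u -> k = (lam x u + #|far x u|).+1.
Proof.
move=> xu; rewrite -(regG x) -/(nbr x) (cardsD1 u) in_nbr xu add1n; congr _.+1.
rewrite -cardsUI [X in _ = _ + X](_ : _ = 0); last first.
  apply/eqP; rewrite cards_eq0; apply/eqP/setP => z; rewrite !inE.
  by case: (adj u z); rewrite ?andbF.
rewrite addn0; apply: eq_card => z; rewrite !inE.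
case: (eqVneq z u) => [->|zu] /=; first by rewrite adj_irrefl !andbF.
by case: (adj x z); case: (adj u z).
Qed.

Lemma lam_ltk x u : adj x u -> lam x u < k.
Proof. by move/far_card; lia. Qed.

Lemma far_exists x u : adj x u -> lam x u < k.-1 ->
  exists d, [/\ adj x d, ~~ adj u d & d != u].
Proof.
move=> xu xuk; have: 0 < #|far x u| by have := far_card xu; lia.
by case/card_gt0P => d; rewrite in_far => /and3P[*]; exists d.
Qed.

Hypothesis muG : forall x y, x != y -> ~~ adj x y -> #|cnbr x y| = 2.

Lemma no_three x y u v w : x != y -> ~~ adj x y ->
  u != v -> u != w -> v != w -> adj x u -> adj y u -> adj x v -> adj y v ->
  adj x w -> adj y w -> False.
Proof.
move=> xy nxy uv uw vw xu yu xv yv xw yw.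
have: #|[set u; v; w]| <= #|cnbr x y|.
  apply/subset_leq_card/subsetP => z; rewrite !inE.
  by case/orP=> [/orP[]|] /eqP->; apply/andP.
by rewrite muG // setUC cardsU1 cards2 !inE negb_or !(eq_sym w) uv uw vw.
Qed.

Lemma other_common x y u : x != y -> ~~ adj x y -> adj x u -> adj y u ->
  exists v, [/\ v != u, adj x v & adj y v].
Proof.
move=> xy nxy xu yu; have := muG xy nxy.
rewrite (cardsD1 u) in_cnbr xu yu => -[] /eqP/cards1P[v /setP/(_ v)].
by rewrite !inE eqxx => /and3P[*]; exists v.
Qed.

Lemma common_exists x y : x != y -> ~~ adj x y -> exists u, adj x u && adj y u.
Proof.
move=> xy nxy; have: 0 < #|cnbr x y| by rewrite muG.
by case/card_gt0P => u; rewrite in_cnbr; exists u.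
Qed.

(** Otherwise [c1] and [c3] would have the three common neighbours [x], [u], [c2]. *)
Lemma diamond x u c1 c2 c3 : adj x u ->
  adj x c1 -> adj u c1 -> adj x c2 -> adj u c2 -> adj x c3 -> adj u c3 ->
  adj c1 c2 -> adj c2 c3 -> c1 != c3 -> adj c1 c3.
Proof.
move=> xu x1 u1 x2 u2 x3 u3 a12 a23 ne13; apply/negPn/negP => n13.
by apply: (@no_three c1 c3 x u c2); gr.
Qed.

Lemma cls_eq x u c c' : adj x u -> c \in cnbr x u -> c' \in cls x u c ->
  cls x u c' = cls x u c.
Proof.
move=> xu; rewrite in_cnbr => /andP[xc uc]; rewrite inE in_cnbr.
case/andP=> /andP[xc' uc'] /orP[/eqP->//|cc'].
apply/setP => z; rewrite !inE; case xz: (adj x z) => //=.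
case uz: (adj u z) => //=.
case: (eqVneq z c) => [->|zc] /=; first by rewrite adj_sym cc' orbT.
case: (eqVneq z c') => [->|zc'] /=; first by rewrite cc'.
apply/idP/idP => [c'z|cz].
  by apply: (@diamond x u c c' z); gr.
by apply: (@diamond x u c' c z); gr.
Qed.

Lemma cls_disjoint x u c c' : adj x u -> c \in cnbr x u -> c' \in cnbr x u ->
  c' \notin cls x u c -> cls x u c :&: cls x u c' = set0.
Proof.
move=> xu cC c'C; apply: contraNeq => /set0Pn[z]; rewrite inE => /andP[zc zc'].
have zC : z \in cnbr x u by move: zc; rewrite inE => /andP[].
rewrite -(cls_eq xu cC zc) (cls_eq xu c'C zc').
by move: c'C; rewrite !inE eqxx => ->.
Qed.

(** The sets [att x u c] are disjoint: a vertex of [far x u] already shares [x] with [u], so it is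
    adjacent to at most one common neighbour of [x] and [u]. *)
Lemma att_card x u (W : {set G}) m : adj x u -> W \subset cnbr x u ->
  (forall c, c \in W -> #|att x u c| = m) -> #|W| * m <= #|far x u|.
Proof.
move=> xu /subsetP sW Wm; rewrite -sum_nat_const.
rewrite -(eq_bigr _ Wm).
under eq_bigr => c _ do rewrite -sum1_card.
rewrite (exchange_big_dep (mem (far x u))) /=; last first.
  by move=> c d _; rewrite inE => /andP[].
rewrite -sum1_card; apply: leq_sum => d; rewrite in_far => /and3P[xd nud du].
rewrite sum1_card; apply/card_le1_eqP => c c'.
case/andP=> cW; rewrite inE => /andP[_ cd].
case/andP=> c'W; rewrite inE => /andP[_ c'd].
move: (sW _ cW) (sW _ c'W); rewrite !in_cnbr => /andP[xc uc] /andP[xc' uc'].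
by apply/eqP/negPn/negP => ne; apply: (@no_three u d x c c'); gr.
Qed.

(** * Quadrangles: the sum condition on [lam] *)

Variable L : nat.
Hypothesis lamG : forall x y u v, x != y -> ~~ adj x y -> u != v ->
  adj x u -> adj y u -> adj x v -> adj y v -> lam y u + lam y v = L.

(** The second common neighbour [w] of [u] and [v] is not adjacent to [x], so [lamG] applies to [w]
    and [x]. *)
Lemma matched x u v : adj x u -> adj x v -> u != v -> ~~ adj u v ->
  (forall w, adj x w -> adj u w -> adj v w -> False) -> lam x u + lam x v = L.
Proof.
move=> xu xv uv nuv nocom.
have [||w [wx uw vw]] := @other_common u v x uv nuv; try gr.
have nxw : ~~ adj x w by apply/negP => xw; exact: (nocom w).
by apply: (@lamG w x u v); gr.
Qed.

Lemma attached x u c d : adj x u -> adj x c -> adj u c -> adj x d ->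
  ~~ adj u d -> d != u -> adj c d -> lam x u + lam u c = L.
Proof.
move=> xu xc uc xd nud du cd; rewrite [lam x u]lamC.
by apply: (@lamG d u x c); gr.
Qed.

Lemma nonadj_classes x u c c' : adj x u -> adj x c -> adj u c ->
  adj x c' -> adj u c' -> c != c' -> ~~ adj c c' -> lam x c + lam u c = L.
Proof.
move=> xu xc uc xc' uc' ne nad; rewrite ![lam _ c]lamC.
by apply: (@lamG c' c x u); gr.
Qed.

(* The neighbour v completes a quadrangle with xu, so the values of lam on
   edges at x come in pairs with sum L. *)
Lemma partner x u : adj x u -> lam x u < k.-1 ->
  exists v, [/\ adj x v, v != u & lam x u + lam x v = L].
Proof.
move=> xu; rewrite lamC => xuk.
have [|e [ue nxe ex]] := @far_exists u x _ xuk; first gr.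
have [| | | |v [vu xv ev]] := @other_common x e u; try gr.
by exists v; split=> //; rewrite [lam u x]lamC; apply: (@lamG e x u v); gr.
Qed.

(** This is the (x, y) entry of the cube of the adjacency matrix. Apart from [u] and [v], the k - 2
    neighbours of [x] are not adjacent to [y] and contribute 2 each. *)
Lemma walk3_nonadj x y u v : x != y -> ~~ adj x y -> u != v ->
  adj x u -> adj y u -> adj x v -> adj y v ->
  \sum_(z in nbr x) lam z y = lam y u + lam y v + 2 * (k - 2).
Proof.
move=> xy nxy uv xu yu xv yv.
rewrite (bigD1 u) ?in_nbr //= (bigD1 v) ?in_nbr ?xv 1?eq_sym //= addnA.
rewrite (lamC u) (lamC v); congr (_ + _).
have -> : (2 * (k - 2))%N = (\sum_(z in nbr x :\: [set u; v]) 2)%N.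
  rewrite sum_nat_const mulnC cardsD (setIidPr _) ?[#|nbr x|](regG x) ?cards2 ?uv //.
  by apply/subsetP => z; rewrite !inE => /orP[] /eqP->.
apply: eq_big => z; first by rewrite !inE negb_or -andbA andbC.
rewrite in_nbr => /andP[/andP[xz zu] zv]; apply: muG.
  by apply: contraNneq nxy => <-.
by apply/negP => zy; apply: (@no_three x y u v z); gr.
Qed.

(** * Split edges, whose common neighbours form more than one clique *)

Definition split_edge x u c1 c2 :=
  [/\ adj x u, c1 \in cnbr x u, c2 \in cnbr x u, c1 != c2 & ~~ adj c1 c2].

(** By [diamond], one of [c1], [c2] lies outside the clique of [c], and [nonadj_classes] applies to
    it and [c]. *)
Lemma split_edge_sum x u c1 c2 c : split_edge x u c1 c2 -> c \in cnbr x u ->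
  lam x c + lam u c = L.
Proof.
case=> xu; rewrite !in_cnbr => /andP[x1 u1] /andP[x2 u2] ne nad /andP[xc uc].
have [E|cne1] := eqVneq c c1; first by subst; apply: (@nonadj_classes x u c1 c2).
have [c1c|nc1c] := boolP (adj c1 c); last first.
  by apply: (@nonadj_classes x u c c1); gr.
have [E|cne2] := eqVneq c c2; first by subst; case/negP: nad.
apply: (@nonadj_classes x u c c2) => //; apply: contra nad => cc2.
exact: (@diamond x u c1 c c2).
Qed.

Lemma split_edge_att x u c : adj x u -> c \in cnbr x u ->
  0 < #|att x u c| -> lam x u + lam u c = L.
Proof.
move=> xu; rewrite in_cnbr => /andP[xc uc] /card_gt0P[d].
rewrite inE in_far => /andP[/and3P[xd nud du] cd].
exact: (@attached x u c d).
Qed.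

Lemma cls_gt0 x u c : c \in cnbr x u -> 0 < #|cls x u c|.
Proof.
by move=> cC; apply/card_gt0P; exists c; move: cC; rewrite !inE eqxx => ->.
Qed.

Lemma cls_sub x u c : cls x u c \subset cnbr x u.
Proof. by apply/subsetP => z; rewrite inE => /andP[]. Qed.

(** A vertex attached on the side of [x] forces lam u c = L - a = b, hence lam x c = a, and
    symmetrically for [u]. Attachment on both sides would give 2b = L, against b < a; the sizes then
    follow from [lam_split]. *)
Lemma split_edge_types x u c1 c2 c a b : split_edge x u c1 c2 ->
  lam x u = a -> a + b = L -> b < a -> c \in cnbr x u ->
  [\/ [/\ 2 * #|cls x u c| = L, #|att x u c| = 0 & #|att u x c| = 0],
      [/\ #|cls x u c| = b, #|att x u c| = a - b & #|att u x c| = 0] |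
      [/\ #|cls x u c| = b, #|att x u c| = 0 & #|att u x c| = a - b]].
Proof.
move=> sp lxu abL ltba cC; have sum := split_edge_sum sp cC.
have [xu _ _ _ _] := sp; have ux : adj u x by gr.
have sx := lam_split xu cC.
have cC' : c \in cnbr u x by rewrite cnbrC.
have su := lam_split ux cC'; rewrite -clsC in su.
have := split_edge_att xu cC; have := split_edge_att ux cC'.
rewrite (lamC u x) lxu => hu hx.
have [ax|ax] := posnP #|att x u c|; have [au|au] := posnP #|att u x c|.
- by constructor 1; split=> //; lia.
- by constructor 3; have := hu au; split=> //; lia.
- by constructor 2; have := hx ax; split=> //; lia.
- by have := hu au; have := hx ax; lia.
Qed.

(* The common neighbours of a split edge with more than L / 2 of them fall into
   cliques of size L / 2 with nothing attached, and cliques of size b to whose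
   members a - b vertices are attached, all on the side of x or all on that of
   u; m1 and m2 count the members of the two kinds. *)
Lemma split_edge_bounds x u c1 c2 a b : split_edge x u c1 c2 ->
  lam x u = a -> a + b = L -> b < a -> a < k.-1 -> exists m1 m2,
  [/\ 0 < b, m1 * (a - b) + a < k, m2 * (a - b) + a < k &
      (2 * b <= a /\ a = m1 + m2) \/
      (b <= m1 + m2 /\ exists2 h, 2 * h = L & a = h + (m1 + m2))].
Proof.
move=> sp lxu abL ltba ak; have [xu c1C c2C ne nad] := sp.
have ux : adj u x by gr.
have ty c := split_edge_types sp lxu abL ltba (c := c).
pose S := [set c in cnbr x u | 2 * #|cls x u c| == L].
pose W1 := [set c in cnbr x u | (c \notin S) && (0 < #|att x u c|)].
pose W2 := [set c in cnbr x u | (c \notin S) && (0 < #|att u x c|)].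
pose W := W1 :|: W2.
have W_b c : c \in cnbr x u -> c \notin S -> #|cls x u c| = b.
  move=> cC; rewrite inE cC /= => /eqP cS.
  by case: (ty c cC) => -[e _ _].
have W1W2 : [disjoint W1 & W2].
  rewrite -setI_eq0; apply/eqP/setP => c; rewrite !inE; apply/negP.
  case/andP=> /and3P[cC _ a1] /and3P[_ _ a2].
  have {}cC : c \in cnbr x u by rewrite inE.
  by case: (ty c cC) => -[_ e1 e2]; move: a1 a2; rewrite e1 e2 ?ltnn.
have SW : [disjoint S & W].
  rewrite -setI_eq0; apply/eqP/setP => c; rewrite in_setI in_setU in_set0.
  by rewrite [c \in W1]in_set [c \in W2]in_set; case: (c \in S); rewrite ?andbF.
have cover : cnbr x u = S :|: W.
  apply/setP => c; rewrite in_setU; apply/idP/idP => [cC|]; last first.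
    by case/orP; rewrite ?in_setU; [|case/orP]; rewrite in_set => /andP[].
  have [//|cS /=] := boolP (c \in S); rewrite in_setU.
  rewrite [c \in W1]in_set [c \in W2]in_set cC cS /=.
  move: cS; rewrite inE cC /= => /eqP cS.
  by case: (ty c cC) => -[e0 e1 e2]; rewrite ?e1 ?e2 ?subn_gt0 ?ltba ?orbT.
have a_sum : a = #|S| + (#|W1| + #|W2|).
  rewrite -lxu /lam cover cardsU (disjoint_setI0 SW) cards0 subn0; congr (_ + _).
  by rewrite cardsU (disjoint_setI0 W1W2) cards0 subn0.
have W1b : #|W1| * (a - b) <= #|far x u|.
  apply: att_card => //; first by apply/subsetP => c; rewrite inE => /andP[].
  move=> c; rewrite inE => /and3P[cC _ a1].
  by case: (ty c cC) => -[_ e1 e2] //; move: a1; rewrite ?e1 ?e2.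
have W2b : #|W2| * (a - b) <= #|far u x|.
  apply: att_card => //.
    by rewrite cnbrC; apply/subsetP => c; rewrite inE => /andP[].
  move=> c; rewrite inE => /and3P[cC _ a1].
  by case: (ty c cC) => -[_ e1 e2] //; move: a1; rewrite ?e1 ?e2.
have fx := far_card xu; have fu := far_card ux; rewrite (lamC u) lxu in fu.
have clsS c c' : c \in cnbr x u -> c' \in cls x u c -> (c' \in S) = (c \in S).
  move=> cC c'c; rewrite [c' \in S]in_set [c \in S]in_set (cls_eq xu cC c'c) cC.
  by rewrite (subsetP (cls_sub x u c) _ c'c).
have disj c c' : c \in cnbr x u -> c' \in cnbr x u -> c' \notin cls x u c ->
    #|cls x u c| + #|cls x u c'| <= a.
  move=> cC c'C nc; rewrite -cardsUI (cls_disjoint xu) // cards0 addn0 -lxu.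
  by apply: subset_leq_card; rewrite subUset !cls_sub.
exists #|W1|, #|W2|.
(* If [S] is empty, [c1] and [c2] lie in disjoint cliques of size b, whence 2b <= a. *)
have [S0|[c0 c0S]] := set_0Vmem S.
  have nS c : c \in S = false by rewrite S0 inE.
  have b1 := W_b c1 c1C; have b2 := W_b c2 c2C.
  rewrite !nS in b1 b2; have := cls_gt0 c1C; have := disj c1 c2 c1C c2C.
  rewrite !inE -!in_cnbr negb_and negb_or nad eq_sym ne orbT b1 // b2 // => hab b0.
  rewrite S0 cards0 add0n in a_sum.
  have ltk m n : m <= n -> k = (a + n).+1 -> m + a < k by clear; lia.
  rewrite lxu in fx; split; [exact: b0 | exact: ltk fx | exact: ltk fu | left].
  by split=> //; rewrite mul2n -addnn; apply: hab.
have c0C : c0 \in cnbr x u by move: c0S; rewrite inE => /andP[].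
have h0 : 2 * #|cls x u c0| = L by move: c0S; rewrite inE => /andP[_ /eqP].
have [Ssub|/subsetPn[c' c'S c'c0]] := boolP (S \subset cls x u c0).
  have Scls : S = cls x u c0.
    apply/eqP; rewrite eqEsubset Ssub; apply/subsetP => c cc.
    by rewrite (clsS c0 c).
  (* An empty [W] would give a = L / 2, contrary to b < a. *)
  have : 0 < #|W|.
    rewrite cardsU (disjoint_setI0 W1W2) cards0 subn0 lt0n; apply/eqP => W0.
    by move: h0 abL ltba a_sum; rewrite W0 Scls addn0; clear; lia.
  case/card_gt0P => c cW.
  have cS : c \notin S by rewrite (disjointFl SW).
  have cC : c \in cnbr x u by rewrite cover in_setU cW orbT.
  have b0 : 0 < b by rewrite -(W_b c cC cS) cls_gt0.
  have bW : b <= #|W1| + #|W2|.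
    rewrite -(W_b c cC cS).
    have <- : #|W| = #|W1| + #|W2|.
      by rewrite cardsU (disjoint_setI0 W1W2) cards0 subn0.
    apply/subset_leq_card/subsetP => z zc.
    have : z \in cnbr x u by apply: (subsetP (cls_sub x u c)).
    by rewrite cover in_setU (clsS c z) // (negPf cS).
  have ltk m n : m <= n -> k = (a + n).+1 -> m + a < k by clear; lia.
  rewrite lxu in fx; split; [exact: b0 | exact: ltk fx | exact: ltk fu | right].
  split=> //.
  by exists #|cls x u c0|; rewrite // -Scls.
have c'C : c' \in cnbr x u by move: c'S; rewrite inE => /andP[].
have h' : 2 * #|cls x u c'| = L by move: c'S; rewrite inE => /andP[_ /eqP].
have := disj _ _ c0C c'C c'c0 => La.
(* Two disjoint cliques of size L / 2 leave b = 0, so no common neighbour has anything attached. Any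
   [d] in [far x u] then has lam x d = 0, and [matched] for [c0] and [d] forces lam x c0 = L, while
   the clique of [c0] provides only L / 2. *)
have b0 : b = 0 by move: La h0 h' abL; clear; lia.
exfalso; have [d [xd nud du]] : exists d, [/\ adj x d, ~~ adj u d & d != u].
  by apply: far_exists; rewrite // lxu.
have noC c : c \in cnbr x u -> ~~ adj c d.
  move=> cC; apply/negP => cd; have := cls_gt0 cC.
  have : 0 < #|att x u c|.
    by apply/card_gt0P; exists d; rewrite inE in_far xd nud du.
  by case: (ty c cC) => -[e0 e1 _]; rewrite e1 ?e0 ?b0.
have ld : lam x u + lam x d = L.
  apply: matched => //; first by gr.
  move=> w xw uw dw; have : w \in cnbr x u by rewrite in_cnbr xw.
  by move/noC; rewrite adj_sym dw.
have d0 : lam x d = 0 by move: ld abL; rewrite lxu b0; clear; lia.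
have : lam x c0 + lam x d = L.
  move: (c0C); rewrite in_cnbr => /andP[xc0 uc0].
  apply: matched => //; [by gr | exact: noC | move=> w xw _ dw].
  by move/eqP: d0; rewrite cards_eq0 => /eqP/setP/(_ w); rewrite !inE xw dw.
have := ty c0 c0C; rewrite (lam_split xu c0C) d0 b0.
by case=> -[e0 -> _]; move: e0 h0 (cls_gt0 c0C); clear; lia.
Qed.

(* The one case left open by [split_bounds_large_sum]: x would have a path
   c2, u, c1, d as neighbourhood, and its ends violate [matched]. *)
Lemma split_edge_four x u c1 c2 : split_edge x u c1 c2 ->
  lam x u = 2 -> L = 3 -> k = 4 -> False.
Proof.
move=> sp l2 L3 k4.
have [xu c1C c2C ne nad] := sp; have ux : adj u x by gr.
have ty c (cC : c \in cnbr x u) :=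
  split_edge_types sp l2 (b := 1) (esym L3) isT cC.
have fx : #|far x u| = 1 by move: (far_card xu); rewrite l2 k4; clear; lia.
have fu : #|far u x| = 1 by move: (far_card ux); rewrite lamC l2 k4; clear; lia.
have Ceq : cnbr x u = [set c1; c2].
  apply/esym/eqP; rewrite eqEcard cards2 ne -/(lam x u) l2 andbT.
  by apply/subsetP => c; rewrite !inE => /orP[] /eqP ->; rewrite -in_cnbr.
(* As L is odd, both cliques are single vertices with one attached vertex each. [far x u] and
   [far u x] have one element, so by [att_card] the two attachments are on different sides. *)
wlog [a1 a2] : c1 c2 sp c1C c2C ne nad Ceq /
    #|att x u c1| = 1 /\ #|att x u c2| = 0.
  move=> th; have := ty c1 c1C; have := ty c2 c2C; rewrite L3.
  have bad y z (S : {set G}) : adj y z -> S \subset cnbr y z -> 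
      #|far y z| = 1 -> #|S| = 2 -> (forall c, c \in S -> #|att y z c| = 1) ->
      False.
    by move=> yz sS f1 S2 /(att_card yz sS); rewrite f1 S2.
  have sym : split_edge x u c2 c1 by split; rewrite // 1?eq_sym // adj_sym.
  case=> -[e20 e21 e22]; [by move: e20; clear; lia | |];
    case=> -[e10 e11 e12]; try by move: e10; clear; lia.
  - case: (bad x u [set c1; c2]); rewrite ?Ceq ?cards2 ?ne //.
    by move=> c; rewrite !inE => /orP[] /eqP ->.
  - by apply: (th c2 c1 sym); rewrite 1?[_ == c1]eq_sym 1?adj_sym // Ceq setUC.
  - by apply: (th c1 c2).
  - case: (bad u x [set c1; c2]); rewrite ?(cnbrC u) ?Ceq ?cards2 ?ne //.
    by move=> c; rewrite !inE => /orP[] /eqP ->.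
have [d] : exists d, d \in att x u c1 by apply/card_gt0P; rewrite a1.
rewrite inE => /andP[dfar c1d]; move: (dfar); rewrite in_far => /and3P[xd nud du].
have nc2d : ~~ adj c2 d.
  apply/negP => c2d; move/eqP: a2; rewrite cards_eq0 => /eqP/setP/(_ d).
  by rewrite in_set dfar c2d inE.
have sub z : adj x z -> adj d z -> z = c1.
  move=> xz dz; case: (boolP (adj u z)) => [uz|nuz].
    have : z \in cnbr x u by rewrite in_cnbr xz.
    by rewrite Ceq !inE => /orP[] /eqP // E; subst; rewrite adj_sym dz in nc2d.
  have zf : z \in far x u by rewrite in_far xz nuz /=; gr.
  have /eqP/cards1P[t ft] := fx; move: zf dfar; rewrite ft !inE.
  by move=> /eqP zt /eqP dt; rewrite zt dt adj_irrefl in dz.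
have ld : lam x d <= 1.
  apply/card_le1_eqP => z z'; rewrite !in_cnbr.
  by move=> /andP[xz dz] /andP[xz' dz']; rewrite (sub z) // (sub z').
move: (c2C); rewrite in_cnbr => /andP[xc2 uc2].
have c2d : c2 != d by gr.
have : lam x c2 + lam x d = L.
  apply: matched => // w xw c2w dw.
  by rewrite (sub w xw dw) adj_sym in c2w; rewrite c2w in nad.
rewrite (lam_split xu c2C) a2.
by rewrite L3; case: (ty c2 c2C); rewrite ?L3 => -[e2 _ _]; move: e2 ld; clear; lia.
Qed.

(** * Grids *)

Section Grid.
Variables a b : nat.
Hypothesis abL : a + b = L.
Hypothesis ltba : b < a.
Hypothesis ak : a < k.-1.
Hypothesis maxa : forall x y, adj x y -> lam x y <= a.
Hypothesis clqa : forall x u c c', adj x u -> lam x u = a ->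
  c \in cnbr x u -> c' \in cnbr x u -> c != c' -> adj c c'.

(** The clique of [c] is all of [cnbr x u], so lam x c is a plus the number of attached vertices,
    and a is the maximum. *)
Lemma max_cls x u c : adj x u -> lam x u = a -> c \in cnbr x u ->
  lam x c = a /\ #|att x u c| = 0.
Proof.
move=> xu lxu cC; have := lam_split xu cC.
have -> : cls x u c = cnbr x u.
  apply/eqP; rewrite eqEsubset cls_sub; apply/subsetP => z zC.
  rewrite in_set zC /=; have [//|ne] := eqVneq z c.
  by apply: (clqa xu lxu); rewrite 1?eq_sym.
move: cC; rewrite -/(lam x u) lxu in_cnbr => /andP[xc _].
have := maxa xc; clear; lia.
Qed.

Lemma max_far x u d : adj x u -> lam x u = a -> adj x d -> ~~ adj u d ->
  d != u -> lam x d = b.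
Proof.
move=> xu lxu xd nud du.
suff : lam x u + lam x d = L by move: lxu abL; clear; lia.
apply: matched => //; first by gr.
move=> w xw uw dw; have wC : w \in cnbr x u by rewrite in_cnbr xw.
have [_ /eqP] := max_cls xu lxu wC; rewrite cards_eq0 => /eqP/setP/(_ d).
by rewrite in_set in_far xd nud du adj_sym dw inE.
Qed.

Definition on_max x := [exists u, adj x u && (lam x u == a)].

Lemma on_maxP x u : adj x u -> lam x u = a -> on_max x.
Proof. by move=> xu lxu; apply/existsP; exists u; rewrite xu lxu eqxx. Qed.

Lemma two_values x d : on_max x -> adj x d -> lam x d = a \/ lam x d = b.
Proof.
case/existsP=> u /andP[xu /eqP lxu] xd.
have [->|du] := eqVneq d u; first by left.
have [ud|nud] := boolP (adj u d); last by right; apply: (@max_far x u).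
by left; case: (@max_cls x u d) => //; rewrite in_cnbr xd.
Qed.

Lemma max_adj x u v : adj x u -> lam x u = a -> adj x v -> lam x v = a ->
  u != v -> adj u v.
Proof.
move=> xu lxu xv lxv uv; apply/negPn/negP => nuv.
have := max_far xu lxu xv nuv; rewrite eq_sym uv lxv => /(_ isT).
by move: ltba; clear; lia.
Qed.

Lemma max_min_nadj x u d : adj x u -> lam x u = a -> adj x d -> lam x d = b ->
  ~~ adj u d.
Proof.
move=> xu lxu xd lxd; apply/negP => ud.
have [|] := @max_cls x u d xu lxu; first by rewrite in_cnbr xd.
by rewrite lxd; move: ltba; clear; lia.
Qed.

(** When lam x d = b, take a quadrangle x, d, e, v. The sum at [x] gives lam x v = a, so [v] is not
    adjacent to [d], and the sum at [d] then gives lam d e = a. *)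
Lemma on_max_nbr x d : on_max x -> adj x d -> on_max d.
Proof.
move=> mx xd; have dx : adj d x by gr.
have [lxd|lxd] := two_values mx xd.
  by apply: (on_maxP dx); rewrite lamC.
have [|e [de nxe ex]] := @far_exists d x dx.
  by rewrite lamC lxd; move: ltba ak; clear; lia.
have [||||v [vd xv ev]] := @other_common x e d; try gr.
have xvL : lam x d + lam x v = L by apply: (@lamG e x d v); gr.
have lxv : lam x v = a by move: xvL abL; rewrite lxd; clear; lia.
have nvd := max_min_nadj xv lxv xd lxd.
have : lam d x + lam d e = L by apply: (@lamG v d x e); gr.
rewrite (lamC d x) lxd => /eqP.
by rewrite -abL addnC eqn_add2r => /eqP; apply: on_maxP.
Qed.

Variables x0 u0 : G.
Hypothesis x0u0 : adj x0 u0.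
Hypothesis lam0 : lam x0 u0 = a.

Lemma on_max_all x : on_max x.
Proof.
have m0 := on_maxP x0u0 lam0.
have [->//|ne] := eqVneq x x0.
have [x0x|nx0x] := boolP (adj x0 x); first exact: (on_max_nbr m0).
have [|u /andP[x0u xu]] := common_exists _ nx0x; first by rewrite eq_sym.
by apply: (@on_max_nbr u); [apply: (on_max_nbr m0)|rewrite adj_sym].
Qed.

Lemma values x d : adj x d -> lam x d = a \/ lam x d = b.
Proof. exact/two_values/on_max_all. Qed.

Lemma min_tri x d c : adj x d -> adj x c -> adj d c ->
  lam x d = b -> lam x c = b -> lam d c = b.
Proof.
move=> xd xc dc lxd lxc; have [ldc|//] := values dc.
have dx : adj d x by gr.
have /negP[] : ~~ adj c x; last by gr.
by apply: (max_min_nadj dc ldc dx); rewrite lamC.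
Qed.

(** For non-adjacent [u], [v], a common neighbour [w] of [x], [u], [v] would have lam x w = b, so
    the triangle x, u, w would have only the value b, and the sum at [u] would be 2b = L. Without
    such [w], [matched] gives the same. *)
Lemma min_adj x u v : adj x u -> lam x u = b -> adj x v -> lam x v = b ->
  u != v -> adj u v.
Proof.
move=> xu lxu xv lxv uv; apply/negPn/negP => nuv.
have [/existsP[w /and3P[xw uw vw]]|] :=
  boolP [exists w, [&& adj x w, adj u w & adj v w]].
  have [lxw|lxw] := values xw.
    by have /negP[] := max_min_nadj xw lxw xu lxu; gr.
  have : lam u x + lam u w = L by apply: (@lamG v u x w); gr.
  rewrite (lamC u x) lxu (@min_tri x u w) //.
  by move: ltba abL; clear; lia.
rewrite negb_exists => /forallP now.
have : lam x u + lam x v = L.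
  by apply: matched => // w xw uw vw; move: (now w); rewrite xw uw vw.
by rewrite lxu lxv; move: ltba abL; clear; lia.
Qed.

Definition same t : rel G := fun x y => (x == y) || (adj x y && (lam x y == t)).

(** The class of [x] consists of [x], [v] and their t common neighbours. *)
Lemma same_set t x v : adj x v -> lam x v = t ->
  (forall u w, adj x u -> lam x u = t -> adj x w -> lam x w = t ->
    u != w -> adj u w) ->
  (forall z, z \in cnbr x v -> lam x z = t) ->
  #|[set y | same t x y]| = t + 2.
Proof.
move=> xv lxv tadj tcn.
have -> : [set y | same t x y] = x |: (v |: cnbr x v).
  apply/setP => y; rewrite !inE /same eq_sym; case: eqVneq => //= yx.
  have [->|yv] := eqVneq y v; first by rewrite xv lxv eqxx.
  apply/andP/andP => -[xy]; first by move/eqP=> lxy; split=> //; apply: tadj; gr.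
  by move=> vy; split=> //; apply/eqP/tcn; rewrite in_cnbr xy.
rewrite !cardsU1 !inE !adj_irrefl /= -/(lam x v) lxv andbF orbF.
by rewrite (adj_neq xv) addnC add1n addn1 addn2.
Qed.

Lemma same_equiv t :
  (forall x u v, adj x u -> lam x u = t -> adj x v -> lam x v = t -> u != v ->
     adj u v /\ lam u v = t) -> equivalence_rel (same t).
Proof.
move=> tri; have sym x y : same t x y = same t y x.
  by rewrite /same eq_sym adj_sym lamC.
have tr y x z : same t x y -> same t y z -> same t x z.
  rewrite sym => /orP[/eqP->//|/andP[yx /eqP lyx]] /orP[/eqP<-|].
    by rewrite sym /same yx lyx eqxx orbT.
  case/andP=> yz /eqP lyz; rewrite /same; have [//|xz /=] := eqVneq x z.
  by have [-> ->] := tri y x z yx lyx yz lyz xz; rewrite eqxx.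
apply/equivalence_relP; split=> [x|x y xy z]; first by rewrite /same eqxx.
apply/idP/idP; first by apply: tr; rewrite sym.
exact: tr.
Qed.

Lemma grid_of_max : isomorphic G (grid (a + 2) (b + 2)) /\ a + b + 2 = k.
Proof.
have eA : equivalence_rel (same a).
  apply: same_equiv => x u v xu lxu xv lxv uv.
  have uvA := max_adj xu lxu xv lxv uv; split=> //.
  have [//|luv] := values uvA; have ux : adj u x by gr.
  have /negP[] : ~~ adj x v; last by [].
  by apply: (@max_min_nadj u) => //; rewrite lamC.
have eB : equivalence_rel (same b).
  apply: same_equiv => x u v xu lxu xv lxv uv.
  have uvA := min_adj xu lxu xv lxv uv; split=> //.
  exact: (@min_tri x).
have cap x y : same a x y -> same b x y -> x = y.
  move=> /orP[/eqP//|/andP[_ /eqP la]] /orP[/eqP//|/andP[_ /eqP lb]].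
  by move: ltba; rewrite -la -lb ltnn.
(* For non-adjacent [x], [y], the values of [lam] on the edges from [x] to the two common neighbours
   sum to a + b, so one of these edges has value a; its other end is the vertex sought. *)
have tot x y : exists z, same a x z && same b z y.
  have [->|xy] := eqVneq x y; first by exists y; rewrite /same eqxx.
  have [axy|naxy] := boolP (adj x y).
    have [l|l] := values axy.
      by exists y; rewrite /same eqxx axy l eqxx orbT.
    by exists x; rewrite /same eqxx axy l eqxx orbT.
  have fin w : adj x w -> adj y w -> lam x w = a ->
      exists z, same a x z && same b z y.
    move=> xw yw lxw; exists w; rewrite /same xw lxw eqxx orbT /=.
    have wy : adj w y by gr.
    have [lwy|->] := values wy; last by rewrite wy eqxx orbT.
    have wx : adj w x by gr.
    by have /negP[] := naxy; apply: (@max_adj w) => //; rewrite lamC.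
  have [u /andP[xu yu]] := common_exists xy naxy.
  have [v [vu xv yv]] := other_common xy naxy xu yu.
  have uvL : lam x u + lam x v = L by apply: (@lamG y x u v); gr.
  have [l|l] := values xu; first exact: (fin u).
  by apply: (fin v) => //; move: uvL abL; rewrite l; clear; lia.
have adjE x y : adj x y = (x != y) && (same a x y || same b x y).
  rewrite /same; have [->|ne /=] := eqVneq x y; first by rewrite adj_irrefl.
  case axy: (adj x y) => //=.
  by have [->|->] := values axy; rewrite eqxx ?orbT.
have iso := grid_of_equivalences x0 eA eB cap tot adjE.
have cA : #|[set y | same a x0 y]| = a + 2.
  apply: (same_set x0u0 lam0); first by move=> u w; apply: max_adj.
  by move=> z zC; have [] := max_cls x0u0 lam0 zC.
have [|v0 [x0v0 _ lv0]] := partner x0u0; first by rewrite lam0.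
have {}lv0 : lam x0 v0 = b by move: lv0 abL; rewrite lam0; clear; lia.
have cB : #|[set y | same b x0 y]| = b + 2.
  apply: (same_set x0v0 lv0); first by move=> u w; apply: min_adj.
  move=> z; rewrite in_cnbr => /andP[x0z v0z].
  have [l|//] := values x0z.
  by have /negP[] := max_min_nadj x0z l x0v0 lv0; gr.
rewrite cA cB in iso; split=> //.
(* The two classes of [x0] cover its closed neighbourhood and meet in [x0]: (a + 2) + (b + 2) = (k +
   1) + 1. *)
have := cardsUI [set y | same a x0 y] [set y | same b x0 y].
have -> : [set y | same a x0 y] :|: [set y | same b x0 y] = x0 |: nbr x0.
  apply/setP => y; rewrite !inE adjE eq_sym; case: eqVneq => //= ->.
  by rewrite /same eqxx.
have -> : [set y | same a x0 y] :&: [set y | same b x0 y] = [set x0].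
  apply/setP => y; rewrite !inE; apply/andP/eqP => [[hA hB]|->].
    by rewrite (cap _ _ hA hB).
  by rewrite /same eqxx.
rewrite cA cB cardsU1 inE adj_irrefl cards1 (regG x0) /=; clear; lia.
Qed.

End Grid.

(** The combinatorial form of the bound on the least eigenvalue: at each vertex the average of [lam]
    over the edges is at least k/3 - 3. *)
Definition large_valency :=
  120 <= k /\ forall x, k * k <= 3 * (\sum_(u in nbr x) lam x u) + 9 * k.

Lemma grid_of_no_twins x1 y1 : adj x1 y1 ->
  (forall x y, adj x y -> lam x y < k.-1) ->
  ~ (exists m, forall x y, adj x y -> lam x y = m) ->
  3 * k <= 4 * L \/ large_valency ->
  exists p q, [/\ q < p, 2 <= q, p + q = k + 2, isomorphic G (grid p q)
                & L + 2 = k].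
Proof.
move=> xy1 ntw nsrg large.
have [[x0 u0] /= x0u0 max0] := @arg_maxnP _ (x1, y1)
  (fun p : G * G => adj p.1 p.2) (fun p : G * G => lam p.1 p.2) xy1.
set a := lam x0 u0 in max0.
have {}max0 x y : adj x y -> lam x y <= a by move=> xy; apply: (max0 (x, y)).
have [v [x0v _ lL]] := partner x0u0 (ntw _ _ x0u0).
pose b := L - a; have abL : a + b = L by move: lL; rewrite /b -/a; clear; lia.
(* If a <= b, then both members of every pair with sum a + b are at most a, hence equal to a, and
   [lam] is constant on edges. *)
have ltba : b < a.
  rewrite ltnNge; apply/negP => leab; apply: nsrg; exists a => x y xy.
  have [w [xw _ lL']] := partner xy (ntw _ _ xy).
  by move: (max0 _ _ xy) (max0 _ _ xw) lL' abL leab; clear; lia.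
have ak : a < k.-1 by apply: ntw.
have clq x u c c' : adj x u -> lam x u = a -> c \in cnbr x u ->
    c' \in cnbr x u -> c != c' -> adj c c'.
  move=> xu lxu cC c'C ne; apply/negPn/negP => nad.
  have sp : split_edge x u c c' by split.
  have [m1 [m2 [b0 h1 h2 h]]] := split_edge_bounds sp lxu abL ltba ak.
  case: large => [kL|[k120 sumk]].
    have [a2 L3 k4] := split_bounds_large_sum abL ltba b0 h1 h2 kL h.
    by apply: (split_edge_four sp); rewrite ?lxu.
  apply: (split_bounds_large_valency abL ltba h1 h2 k120 _ h).
  have : \sum_(w in nbr x) lam x w <= k * a.
    rewrite -(regG x) -/(nbr x) -sum_nat_const; apply: leq_sum => w.
    by rewrite in_nbr; apply: max0.
  by move: (sumk x) k120; move: (\sum_(w in _) _) => s; clear; nia.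
have [iso abk] := grid_of_max abL ltba ak max0 clq x0u0 erefl.
by exists (a + 2), (b + 2); split=> //; move: abk abL ltba; clear; lia.
Qed.

(** * Twins *)

Hypothesis ncG : ~ is_complete G.

(** If the neighbours of [x] formed a clique, each of them would have [x] as a twin, so none would
    have a neighbour at distance two from [x]; diameter 2 would make the graph complete. *)
Lemma nbr_not_clique x :
  exists c c', [/\ adj x c, adj x c', c != c' & ~~ adj c c'].
Proof.
have [/existsP[c /existsP[c' /and4P[*]]]|] := boolP
  [exists c, exists c', [&& adj x c, adj x c', c != c' & ~~ adj c c']].
  by exists c, c'.
rewrite negb_exists => /forallP nc; case: ncG.
have clq c c' : adj x c -> adj x c' -> c != c' -> adj c c'.
  move=> xc xc' ne; have := nc c; rewrite negb_exists => /forallP/(_ c').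
  by rewrite xc xc' ne /= => /negPn.
have all_nbr y : y != x -> adj x y.
  move=> yx; apply/negPn/negP => nxy.
  have [|u /andP[xu yu]] := common_exists _ nxy; first by gr.
  have ux : adj u x by gr.
  have fx : #|far x u| = 0.
    apply/eqP; rewrite cards_eq0; apply/eqP/setP => d; rewrite in_far inE.
    by apply/negP => /and3P[xd nud du]; case/negP: nud; apply: clq; gr.
  have : 0 < #|far u x|.
    by apply/card_gt0P; exists y; rewrite in_far nxy yx !andbT; gr.
  move: (far_card xu) (far_card ux); rewrite fx (lamC u); clear; lia.
move=> y z yz; have [E|yx] := eqVneq y x.
  by rewrite E; apply: all_nbr; rewrite -E eq_sym.
have [E|zx] := eqVneq z x; first by rewrite E adj_sym all_nbr.
by apply: clq => //; apply: all_nbr.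
Qed.

(** The value k - 1 is the largest possible and means that the closed neighbourhoods coincide. *)
Definition twin x y := adj x y && (lam x y == k.-1).

Lemma twinC x y : twin x y = twin y x.
Proof. by rewrite /twin adj_sym lamC. Qed.

Lemma twin_far x u : twin x u -> far x u = set0.
Proof.
case/andP=> xu /eqP lxu; apply/eqP; rewrite -cards_eq0.
by move: (far_card xu) (lam_ltk xu); rewrite lxu; clear; lia.
Qed.

Lemma twin_adj x u z : twin x u -> z != x -> z != u -> adj x z = adj u z.
Proof.
move=> tw zx zu; apply/idP/idP => h.
  have /setP/(_ z) := twin_far tw; rewrite in_far in_set0 h zu andbT.
  by move/negbFE.
rewrite twinC in tw; have /setP/(_ z) := twin_far tw.
by rewrite in_far in_set0 h zx andbT => /negbFE.
Qed.

Lemma twin_nbr x u z : twin x u -> adj x z -> z != u -> adj u z.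
Proof. by move=> tw xz zu; rewrite -(twin_adj tw) //; gr. Qed.

Lemma twin_nonadj x u c c' : twin x u -> adj x c -> adj x c' -> c != c' ->
  ~~ adj c c' -> c != u.
Proof.
move=> tw xc xc' ne; apply: contraNneq => cu.
by rewrite cu; apply: (twin_nbr tw); rewrite // -cu eq_sym.
Qed.

Lemma twin_split x u : twin x u -> exists c1 c2, split_edge x u c1 c2.
Proof.
move=> tw; have [c [c' [xc xc' ne nad]]] := nbr_not_clique x.
have /andP[xu _] := tw.
have cu : c != u by apply: (twin_nonadj tw xc xc').
have c'u : c' != u by apply: (twin_nonadj tw xc' xc); gr.
by exists c, c'; split=> //; rewrite in_cnbr ?xc ?xc' (twin_nbr tw).
Qed.

(** The edge between twins is split and has nothing attached, so lam x c and lam u c both equal the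
    size of the clique of [c], and they sum to L. *)
Lemma twin_lam x u c : twin x u -> adj x c -> c != u ->
  lam x c = #|cls x u c| /\ 2 * lam x c = L.
Proof.
move=> tw xc cu; have [c1 [c2 sp]] := twin_split tw; have [xu _ _ _ _] := sp.
have cC : c \in cnbr x u by rewrite in_cnbr xc (twin_nbr tw).
have ux : adj u x by gr.
have attx : att x u c = set0 by rewrite /att twin_far // setIdE set0I.
have attu : att u x c = set0 by rewrite /att twin_far 1?twinC // setIdE set0I.
have cC' : c \in cnbr u x by rewrite cnbrC.
have := split_edge_sum sp cC; rewrite (lam_split xu cC) (lam_split ux cC').
by rewrite attx attu (clsC u) cards0; clear; lia.
Qed.

(** Two non-adjacent neighbours of [x] would have [x], [u] and [v] in common. *)
Lemma twin_uniq x u v : twin x u -> twin x v -> u = v.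
Proof.
move=> twu twv; apply/eqP/negPn/negP => uv.
have [c1 [c2 [xu]]] := twin_split twu.
rewrite !in_cnbr => /andP[x1 u1] /andP[x2 u2] ne nad.
have /andP[xv _] := twv.
have v1 : c1 != v by apply: (twin_nonadj twv x1 x2).
have v2 : c2 != v by apply: (twin_nonadj twv x2 x1); gr.
have a1 := twin_nbr twv x1 v1; have a2 := twin_nbr twv x2 v2.
by apply: (@no_three c1 c2 x u v); gr.
Qed.

(** Let [e] be adjacent to [c] but not to [x]; the other common neighbour [c'] of [x] and [e] is the
    twin. If not, some [f] is adjacent to [c] but not to [c'], and the sum for [f] and [c'] is L,
    although its two terms are at least L / 2 and one of them is larger. *)
Lemma twin_of_nbr x u c : twin x u -> adj x c -> exists c', twin c c'.
Proof.
move=> tw xc; have /andP[xu _] := tw.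
have [->|cu] := eqVneq c u; first by exists x; rewrite twinC.
have [c1 [c2 sp]] := twin_split tw; have [_ + _ _ _] := sp.
rewrite in_cnbr => /andP[x1 u1].
have uc := twin_nbr tw xc cu; have cx : adj c x by gr.
have [|e [ce nxe ex]] := @far_exists c x cx.
  rewrite lamC; have [l _] := twin_lam tw xc cu.
  (* The clique of [c] cannot contain both [c1] and [c2]. *)
  have : #|cls x u c| < lam x u.
    apply: proper_card; rewrite properE cls_sub; apply/subsetPn.
    have [_ c1C c2C ne nad] := sp.
    case: (boolP (c1 \in cls x u c)) => [h|]; last by exists c1.
    exists c2 => //; rewrite -(cls_eq xu _ h) ?in_cnbr ?xc //.
    by rewrite in_set negb_and negb_or nad eq_sym ne orbT.
  by move: (lam_ltk xu) l; clear; lia.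
have nue : ~~ adj u e by rewrite -(twin_adj tw) //; gr.
have class f : adj c f -> ~~ adj x f -> f != x ->
    exists c', [/\ c' != c, adj x c', adj f c', adj u c' & adj c c'].
  move=> cf nxf fx; have nuf : ~~ adj u f by rewrite -(twin_adj tw) //; gr.
  have [||||c' [c'c xc' fc']] := @other_common x f c; try gr.
  have uc' : adj u c' by apply: (twin_nbr tw) => //; gr.
  exists c'; split=> //; apply/negPn/negP => ncc'.
  by apply: (@no_three c c' x u f); gr.
have [c' [c'c xc' ec' uc' cc']] := class e ce nxe ex.
have c'u : c' != u by gr.
have [lc dlc] := twin_lam tw xc cu; have [_ dlc'] := twin_lam tw xc' c'u.
exists c'; rewrite /twin cc' /=.
have := lam_ltk cc'; rewrite eqn_leq => lk.
rewrite -ltnS prednK ?lk /=; last by move: lk; clear; lia.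
rewrite leqNgt; apply/negP => lt.
have [f [cf nc'f fc']] := far_exists cc' lt.
have nxf : ~~ adj x f.
  apply/negP => xf; case/negP: nc'f.
  have [fu|fu] := eqVneq f u; first by rewrite fu; gr.
  have uf := twin_nbr tw xf fu.
  by apply: (@diamond x u c' c f); gr.
have fx : f != x by gr.
have [c2' [c2c xc2 fc2 uc2 cc2]] := class f cf nxf fx.
have c'c2 : c' != c2' by gr.
have ac'c2 : adj c' c2' by apply: (@diamond x u c' c c2'); gr.
have c2u : c2' != u by gr.
have sum : lam c' c + lam c' c2' = L by apply: (@lamG f c' c c2'); gr.
(* x and e are common neighbours of c and c' besides those in N(x). *)
have le1 : lam x c < lam c' c.
  have <- : #|x |: (e |: (cnbr x c :\ c'))| = (lam x c).+1.
    rewrite !cardsU1 !inE adj_irrefl /= (negPf nxe) !andbF orbF eq_sym ex /=.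
    by rewrite /lam (cardsD1 c' (cnbr x c)) in_cnbr xc' cc'.
  apply/subset_leq_card/subsetP => z; rewrite !inE.
  case/or3P => [/eqP->|/eqP->|/and3P[zc' xz cz]].
  - by apply/andP; split; gr.
  - by apply/andP; split; gr.
  - rewrite cz andbT; have [->|zu] := eqVneq z u; first by gr.
    have uz := twin_nbr tw xz zu.
    by apply: (@diamond x u c' c z); gr.
have le2 : lam x c' <= lam c' c2'.
  have <- : #|x |: (cnbr x c' :\ c2')| = lam x c'.
    rewrite !cardsU1 !inE adj_irrefl /= !andbF.
    by rewrite /lam (cardsD1 c2' (cnbr x c')) in_cnbr xc2 ac'c2.
  apply/subset_leq_card/subsetP => z; rewrite !inE.
  case/orP => [/eqP->|/and3P[zc2 xz c'z]]; first by apply/andP; split; gr.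
  rewrite c'z /=; have [->|zu] := eqVneq z u; first by gr.
  have uz := twin_nbr tw xz zu.
  by apply: (@diamond x u c2' c' z); gr.
by move: sum le1 le2 dlc dlc'; clear; lia.
Qed.

Lemma twin_all x u y : twin x u -> exists v, twin y v.
Proof.
move=> tw; have [->|yx] := eqVneq y x; first by exists u.
have [xy|nxy] := boolP (adj x y); first exact: (twin_of_nbr tw).
have [|w /andP[xw yw]] := common_exists _ nxy; first by gr.
have [w' tww'] := twin_of_nbr tw xw.
by apply: (twin_of_nbr tww'); gr.
Qed.

(** * Graphs in which every vertex has a twin *)

Section Twins.
Variable tw : G -> G.
Hypothesis twP : forall x, twin x (tw x).

Lemma adj_tw x : adj x (tw x). Proof. by have /andP[] := twP x. Qed.

Lemma tw_neq x : tw x != x. Proof. by rewrite eq_sym (adj_neq (adj_tw x)). Qed.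

Lemma twK x : tw (tw x) = x.
Proof. by apply: (@twin_uniq (tw x)) => //; rewrite twinC. Qed.

Lemma adj_twl x z : z != x -> z != tw x -> adj (tw x) z = adj x z.
Proof. by move=> zx ztw; rewrite (twin_adj (twP x)). Qed.

Lemma neq_tw x y z : adj x z -> ~~ adj y z -> z != y -> x != tw y.
Proof.
move=> xz nyz zy; apply: contraNneq nyz => E.
by rewrite -adj_twl // -E // eq_sym (adj_neq xz).
Qed.

Lemma nadj_neq_tw x y : ~~ adj x y -> x != tw y.
Proof. by apply: contraNneq => ->; rewrite adj_sym adj_tw. Qed.

Lemma common_tw x y w : x != y -> ~~ adj x y -> adj x w -> adj y w ->
  adj x (tw w) /\ adj y (tw w).
Proof.
move=> xy nxy xw yw; have nyx : ~~ adj y x by gr.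
have wx : adj w x by gr. have wy : adj w y by gr.
have xtw : x != tw w.
  by apply: contraNneq nxy => E; rewrite E adj_twl // -?E //; gr.
have ytw : y != tw w.
  by apply: contraNneq nyx => E; rewrite E adj_twl // -?E //; gr.
by rewrite !(adj_sym _ (tw w)) !adj_twl //; gr.
Qed.

(** By [common_tw] the vertices [w] and [tw w] already exhaust the two common neighbours. *)
Lemma common_pair x y w v : x != y -> ~~ adj x y -> adj x w -> adj y w ->
  adj x v -> adj y v -> v != w -> v = tw w.
Proof.
move=> xy nxy xw yw xv yv vw; have [xtw ytw] := common_tw xy nxy xw yw.
apply/eqP/negPn/negP => vtw.
by apply: (@no_three x y w (tw w) v) => //; rewrite eq_sym // tw_neq.
Qed.

Lemma far_nadj x d g c : adj x d -> adj x c -> ~~ adj c d -> c != d ->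
  adj d g -> ~~ adj x g -> g != x -> ~~ adj c g.
Proof.
move=> xd xc ncd cd dg nxg gx; apply/negP => cg.
have E : c = tw d by apply: (@common_pair x g); gr.
by case/negP: ncd; rewrite E adj_sym adj_tw.
Qed.

(** The vertices x, c, f, g, d form an induced pentagon. Any chord at [f] would make it the twin of
    [d], or [d] the twin of [c], by [common_pair]. *)
Lemma spread x d g c : adj x d -> adj x c -> ~~ adj c d -> c != d ->
  adj d g -> ~~ adj x g -> g != x ->
  exists f, [/\ adj c f, adj g f, ~~ adj x f & ~~ adj d f].
Proof.
move=> xd xc ncd cd dg nxg gx.
have ncg := far_nadj xd xc ncd cd dg nxg gx.
have [|f /andP[cf gf]] := common_exists _ ncg; first by gr.
have nxf : ~~ adj x f.
  apply/negP => xf; have [fd|fd] := eqVneq f d.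
    by case/negP: ncd; rewrite -fd.
  have E : f = tw d by apply: (@common_pair x g); gr.
  have ctw := nadj_neq_tw ncd.
  case/negP: ncd; rewrite adj_sym -adj_twl //.
  by rewrite -E adj_sym.
exists f; split=> //; apply/negP => df.
have E : d = tw c by apply: (@common_pair x f); gr.
by case/negP: ncd; rewrite E adj_tw.
Qed.

(** By [common_pair], [c2] is not adjacent to [f1]. If [f1] and [f2] were adjacent, then [f1] and
    [c2] would share [c1], [tw c1] and [f2]. *)
Lemma spread_nadj x c1 c2 f1 f2 : adj x c1 -> adj x c2 -> adj c1 c2 ->
  c2 != tw c1 -> adj c1 f1 -> ~~ adj x f1 -> f1 != x -> adj c2 f2 ->
  ~~ adj x f2 -> f2 != x -> f1 != f2 /\ ~~ adj f1 f2.
Proof.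
move=> x1 x2 c12 ctw cf1 nxf1 f1x cf2 nxf2 f2x.
have nc2f1 : ~~ adj c2 f1.
  apply/negP => c2f1; case/negP: ctw; apply/eqP.
  by apply: (@common_pair x f1); gr.
split; first by gr.
apply/negP => f12.
have [xtw f1tw] : adj x (tw c1) /\ adj f1 (tw c1) by apply: common_tw; gr.
have c2tw : adj c2 (tw c1) by rewrite adj_sym adj_twl //; gr.
by apply: (@no_three f1 c2 f2 c1 (tw c1)); rewrite 1?[c1 == _]eq_sym ?tw_neq //; gr.
Qed.

(** The members of [S] lie in distinct cliques of size L / 2 among the k - 1 common neighbours of
    [x] and [tw x]. Having two members keeps [tw x] out of [S]. *)
Lemma indep_bound x (S : {set G}) : S \subset nbr x ->
  {in S &, forall c c', c != c' -> ~~ adj c c'} -> 1 < #|S| ->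
  #|S| * L <= 2 * k.-1.
Proof.
move=> /subsetP Sx ind S2; have xtw := adj_tw x.
have Sl c : c \in S -> c != tw x.
  move=> cS; have : 0 < #|S :\ c| by move: S2; rewrite (cardsD1 c) cS; clear; lia.
  case/card_gt0P => c'; rewrite !inE => /andP[c'c c'S].
  have := Sx _ cS; have := Sx _ c'S; rewrite !in_nbr => xc' xc.
  by apply: (twin_nonadj (twP x) xc xc'); rewrite 1?eq_sym // ind // eq_sym.
have SC c : c \in S -> c \in cnbr x (tw x).
  by move=> cS; have := Sx _ cS; rewrite in_nbr in_cnbr => xc;
     rewrite xc (twin_nbr (twP x)) // Sl.
have cl c : c \in S -> 2 * #|cls x (tw x) c| = L.
  move=> cS; have := Sx _ cS; rewrite in_nbr => xc.
  by have [<-] := twin_lam (twP x) xc (Sl c cS).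
have /andP[_ /eqP <-] := twP x.
rewrite -sum_nat_const -(eq_bigr _ cl) -big_distrr leq_mul2l /=.
under eq_bigr => c _ do rewrite -sum1_card.
rewrite (exchange_big_dep (mem (cnbr x (tw x)))) /=; last first.
  by move=> c d _ dc; apply: (subsetP (cls_sub x (tw x) c)).
rewrite -[lam x _]sum1_card; apply: leq_sum => z zC.
rewrite sum1_card; apply/card_le1_eqP => c c' /andP[cS zc] /andP[c'S zc'].
apply/eqP/negPn/negP => cc'; have := ind c c' cS c'S; rewrite eq_sym cc' => /(_ isT).
have : c' \in cls x (tw x) c.
  rewrite -(cls_eq xtw (SC c cS) zc) (cls_eq xtw (SC c' c'S) zc').
  by rewrite in_set SC // eqxx.
by rewrite in_set (negPf cc') /= => /andP[_ ->].
Qed.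

Lemma indep_seq_bound x (s : seq G) : all (adj x) s ->
  pairwise (fun c c' => (c != c') && ~~ adj c c') s -> 1 < size s ->
  size s * L <= 2 * k.-1.
Proof.
move=> /allP sx pw s1.
have us : uniq s.
  by rewrite uniq_pairwise; apply: sub_pairwise pw => c c' /andP[].
have cs : #|[set c in s]| = size s by rewrite cardsE; apply/card_uniqP.
rewrite -cs; apply: (@indep_bound x); last by rewrite cs.
  by apply/subsetP => c; rewrite in_set in_nbr; apply: sx.
move=> c c'; rewrite !in_set => cin c'in cc'.
have sym : symmetric (fun c c' : G => (c != c') && ~~ adj c c').
  by move=> u v; rewrite eq_sym adj_sym.
by have /andP[] := pairwise_sym_in sym pw cin c'in cc'.
Qed.

Lemma class_avoid x c d (s : seq G) : adj x c -> adj x d -> c != d ->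
  ~~ adj c d -> tw x \in s -> size s < lam x c ->
  exists c2, [/\ adj x c2, adj c c2, c2 \notin s & ~~ adj c2 d].
Proof.
move=> xc xd cd ncd txs ls.
have : 0 < #|cnbr x c :\: [set z in s]|.
  rewrite cardsD subn_gt0; apply: leq_ltn_trans ls.
  by apply: leq_trans (subset_leq_card (subsetIr _ _)) _; rewrite cardsE card_size.
case/card_gt0P => c2; rewrite !inE => /andP[c2s /andP[xc2 cc2]].
exists c2; split=> //; apply/negP => c2d; case/negP: (ncd).
have ctw : c != tw x by apply: (twin_nonadj (twP x) xc xd).
have dtw : d != tw x by apply: (twin_nonadj (twP x) xd xc); gr.
have c2tw : c2 != tw x by apply: contraNneq c2s => ->.
apply: (@diamond x (tw x) c c2 d) => //; first exact: adj_tw.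
all: by apply: (twin_nbr (twP x)).
Qed.

Lemma far_far x d c : adj x d -> adj x c -> ~~ adj c d -> c != d ->
  exists g, [/\ adj d g, ~~ adj x g & g != x].
Proof.
move=> xd xc ncd cd; apply: far_exists; first by gr.
rewrite lamC; have := lam_ltk xd; have := far_card xd.
have : 0 < #|far x d| by apply/card_gt0P; exists c; rewrite in_far xc cd andbT; gr.
by clear; lia.
Qed.

(** A third common neighbour of [x] and [c] yields [c2] in the clique of [c], not its twin. The
    pentagons through [c] and [c2] give [f1], [f2], and d, f1, f2 are independent in the
    neighbourhood of [g]. *)
Lemma class3_bound x c d : adj x c -> adj x d -> c != d -> ~~ adj c d ->
  2 < lam x c -> 3 * L <= 2 * k.-1.
Proof.
move=> xc xd cd ncd l3.
have [||c2 [xc2 cc2 c2s nc2d]] := @class_avoid x c d [:: tw x; tw c] xc xd cd ncd.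
- by rewrite mem_head.
- exact: l3.
move: c2s; rewrite !inE negb_or => /andP[c2x c2c].
have [g [dg nxg gx]] := far_far xd xc ncd cd.
have c2d : c2 != d by gr.
have [f1 [cf1 gf1 nxf1 ndf1]] := spread xd xc ncd cd dg nxg gx.
have [f2 [cf2 gf2 nxf2 ndf2]] := spread xd xc2 nc2d c2d dg nxg gx.
have [f12 nf12] : f1 != f2 /\ ~~ adj f1 f2.
  by apply: (@spread_nadj x c c2); gr.
have df1 : d != f1 by gr. have df2 : d != f2 by gr.
apply: (@indep_seq_bound g [:: d; f1; f2]) => //=.
  by rewrite gf1 gf2 adj_sym dg.
by rewrite df1 df2 ndf1 ndf2 f12 nf12.
Qed.

Lemma class5_bound x c d : adj x c -> adj x d -> c != d -> ~~ adj c d ->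
  4 < lam x c -> 4 * L <= 2 * k.-1.
Proof.
move=> xc xd cd ncd l5.
have [||c2 [xc2 cc2 c2s nc2d]] := @class_avoid x c d [:: tw x; tw c] xc xd cd ncd.
- by rewrite mem_head.
- by apply: leq_trans l5.
move: c2s; rewrite !inE negb_or => /andP[c2x c2c].
have [||c3 [xc3 cc3 c3s nc3d]] :=
  @class_avoid x c d [:: tw x; tw c; c2; tw c2] xc xd cd ncd.
- by rewrite mem_head.
- exact: l5.
move: c3s; rewrite !inE !negb_or => /and4P[c3x c3c c3c2 c3t2].
have [g [dg nxg gx]] := far_far xd xc ncd cd.
have c2d : c2 != d by gr. have c3d : c3 != d by gr.
have ctw : c != tw x by apply: (twin_nonadj (twP x) xc xd).
have c23 : adj c2 c3.
  apply: (@diamond x (tw x) c2 c c3); rewrite ?adj_tw ?(twin_nbr (twP x)) //; gr.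
have [f1 [cf1 gf1 nxf1 ndf1]] := spread xd xc ncd cd dg nxg gx.
have [f2 [cf2 gf2 nxf2 ndf2]] := spread xd xc2 nc2d c2d dg nxg gx.
have [f3 [cf3 gf3 nxf3 ndf3]] := spread xd xc3 nc3d c3d dg nxg gx.
have [f12 nf12] : f1 != f2 /\ ~~ adj f1 f2.
  by apply: (@spread_nadj x c c2); gr.
have [f13 nf13] : f1 != f3 /\ ~~ adj f1 f3.
  by apply: (@spread_nadj x c c3); gr.
have [f23 nf23] : f2 != f3 /\ ~~ adj f2 f3.
  by apply: (@spread_nadj x c2 c3); gr.
have df1 : d != f1 by gr. have df2 : d != f2 by gr. have df3 : d != f3 by gr.
apply: (@indep_seq_bound g [:: d; f1; f2; f3]) => //=.
  by rewrite gf1 gf2 gf3 adj_sym dg.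
by rewrite df1 df2 df3 ndf1 ndf2 ndf3 f12 nf12 f13 nf13 f23 nf23.
Qed.

(** With s = L / 2 the sum at [x] is (k - 1)(s + 1). Either s <= 4, or [class5_bound] gives 4s <= k
    - 1; both are too small for k >= 120. *)
Lemma twins_large_valency (x : G) : large_valency -> False.
Proof.
case=> k120 /(_ x); have [c [d [xc xd cd ncd]]] := nbr_not_clique x.
have lt v : adj x v -> v != tw x -> 2 * lam x v = L.
  by move=> xv vt; have [] := twin_lam (twP x) xv vt.
have := lt c xc (twin_nonadj (twP x) xc xd cd ncd).
have := class5_bound xc xd cd ncd; move: (lam x c) => s s5 sL.
have -> : \sum_(v in nbr x) lam x v = k.-1 + k.-1 * s.
  rewrite (bigD1 (tw x)) ?in_nbr ?adj_tw //=; congr (_ + _).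
    by have /andP[_ /eqP] := twP x.
  have -> : k.-1 = #|nbr x :\ tw x|.
    by have := regG x; rewrite -/(nbr x) (cardsD1 (tw x)) in_nbr adj_tw => <-.
  rewrite -sum_nat_const; apply: eq_big => v; first by rewrite !inE andbC.
  by rewrite in_nbr => /andP[xv /(lt v xv)]; move: sL; clear; lia.
have kE : k = k.-1.+1 by move: k120; clear; lia.
have [/s5|] := ltnP 4 s; rewrite kE in k120 *; move: sL k120; clear; nia.
Qed.

Lemma adj_twr x c : adj x c -> c != tw x -> adj x (tw c).
Proof.
move=> xc ct; rewrite adj_sym adj_twl; [gr | gr |].
by rewrite -(inj_eq (can_inj twK)) twK eq_sym.
Qed.

Hypothesis kL : 3 * k <= 4 * L.

(** [class3_bound] contradicts 3k <= 4L, so lam x c <= 2, and [tw x], [tw c] give equality. Thus L =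
    4 and k <= 5, while the independent pair [c], [d] gives k >= 5. *)
Lemma twins_parameters x c d : adj x c -> adj x d -> c != d -> ~~ adj c d ->
  k = 5.
Proof.
move=> xc xd cd ncd; have ctx := twin_nonadj (twP x) xc xd cd ncd.
have [_ sL] := twin_lam (twP x) xc ctx.
have le2 : lam x c <= 2.
  rewrite leqNgt; apply/negP => /(class3_bound xc xd cd ncd).
  by move: kL (lam_ltk xc); clear; lia.
have ge2 : 1 < lam x c.
  have xtc : adj x (tw c) by apply: adj_twr.
  apply/card_gt1P; exists (tw x), (tw c); rewrite !in_cnbr !adj_tw xtc /=.
  split=> //; first by rewrite adj_sym adj_twl //; gr.
  by rewrite (inj_eq (can_inj twK)); gr.
have := @indep_seq_bound x [:: c; d]; rewrite /= xc xd cd ncd => /(_ isT isT isT).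
by move: sL le2 ge2 kL; clear; lia.
Qed.

Lemma pentagon_nbr y p q z : k = 5 -> adj y p -> adj y q -> p != q ->
  ~~ adj p q -> adj y z -> z \in [:: tw y; p; tw p; q; tw q].
Proof.
move=> k5 yp yq pq npq yz; set s := [:: _; _; _; _; _].
have pt : p != tw y by apply: (twin_nonadj (twP y) yp yq).
have qt : q != tw y by apply: (twin_nonadj (twP y) yq yp); gr.
have nqp : ~~ adj q p by gr.
have us : uniq s.
  rewrite /= !inE !negb_or !(inj_eq (can_inj twK)) !(eq_sym (tw _)) pt qt pq.
  rewrite (adj_neq yp) (adj_neq yq) (nadj_neq_tw nqp) (nadj_neq_tw npq) !andbT /=.
  by rewrite eq_sym tw_neq eq_sym tw_neq.
have sy : [set z in s] \subset nbr y.
  apply/subsetP => t; rewrite in_set in_nbr.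
  by do ![case/predU1P=> [->|]] => //; rewrite ?adj_tw ?adj_twr.
have : [set z in s] == nbr y.
  by rewrite eqEcard sy [#|nbr y|](regG y) k5 cardsE (card_uniqP us).
by move/eqP/setP/(_ z); rewrite in_set in_nbr yz.
Qed.

Lemma pentagon_of_twins (x : G) :
  isomorphic G (clique_extension 2 (cycle_graph 5)).
Proof.
have [c [d [xc xd cd ncd]]] := nbr_not_clique x.
have k5 := twins_parameters xc xd cd ncd.
have dc : d != c by gr. have ndc : ~~ adj d c by gr.
have [e [ce nxe ex]] := far_far xc xd ndc dc.
have [h [dh nxh hx]] := far_far xd xc ncd cd.
have nde := far_nadj xc xd ndc dc ce nxe ex.
have nch := far_nadj xd xc ncd cd dh nxh hx.
have cx : adj c x by gr. have dx : adj d x by gr.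
have xe : x != e by gr. have xh : x != h by gr.
have ctx := twin_nonadj (twP x) xc xd cd ncd.
have dtx := twin_nonadj (twP x) xd xc dc ndc.
have twxN y : ~~ adj x y -> y != x -> ~~ adj (tw x) y.
  move=> nxy yx; rewrite adj_twl //.
  by apply: contraNneq nxy => ->; apply: adj_tw.
(* A common neighbour of [c] and [h] is one of the five neighbours of [c]; all but [e] and [tw e]
   are excluded, and either one makes [e] adjacent to [h]. *)
have eh : adj e h.
  have ch : c != h by gr.
  have [w /andP[cw hw]] := common_exists ch nch.
  have := pentagon_nbr k5 cx ce xe nxe cw; rewrite !inE.
  case/or4P => [/eqP E|/eqP E|/eqP E|/orP[]/eqP E].
  - by case/negP: nch; rewrite -adj_twl -?E; gr.
  - by case/negP: nxh; rewrite -E; gr.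
  - by case/negP: (twxN h nxh hx); rewrite -E; gr.
  - by rewrite -E; gr.
  - by rewrite -adj_twl -?E; gr.
pose s := [:: x; c; e; h; d].
pose v (i : 'I_5) := nth x s i.
have vadj i j : adj (v i) (v j) = cycle_adj i j.
  case: i j => [[|[|[|[|[|//]]]]] hi] [[|[|[|[|[|//]]]]] hj]; rewrite /v /=;
    first [ by rewrite adj_irrefl
          | by have -> : cycle_adj (Ordinal hi) (Ordinal hj) = true by []; gr
          | have -> : cycle_adj (Ordinal hi) (Ordinal hj) = false by [];
            by apply: negPf; gr].
have vneq i j : i != j -> (v i != v j) && (v i != tw (v j)).
  case/pentagon_separated => m /and3P[im njm mj]; rewrite -!vadj in im njm.
  have vmj : v i != v j by gr.
  rewrite vmj; apply: (neq_tw im njm).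
  have [m' /and3P[]] := pentagon_separated mj; rewrite -!vadj => mm' njm' _.
  by gr.
pose g (u : clique_extension 2 (cycle_graph 5)) :=
  if u.2 == ord0 then v u.1 else tw (v u.1).
have ord2 (i j : 'I_2) : (i == ord0) = (j == ord0) -> i = j.
  by case: i j => [[|[|//]] hi] [[|[|//]] hj] //= _; apply: val_inj.
have vtw i j : v i != tw (v j).
  have [->|/vneq/andP[]//] := eqVneq i j.
  by rewrite eq_sym tw_neq.
have ginj : injective g.
  move=> [i a] [j b]; rewrite /g /= => gij.
  have ij : i = j.
    apply/eqP/negPn/negP => /vneq/andP[vij _]; move: gij.
    case: (a == ord0); case: (b == ord0) => /eqP; rewrite ?(negPf vij) //.
    - by rewrite (negPf (vtw i j)).
    - by rewrite eq_sym (negPf (vtw j i)).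
    - by rewrite (inj_eq (can_inj twK)) (negPf vij).
  rewrite ij in gij *; congr (_, _); apply: ord2; move: gij.
  case: (a == ord0); case: (b == ord0) => // /eqP.
    by rewrite (negPf (vtw j j)).
  by rewrite eq_sym (negPf (vtw j j)).
have gadj : {mono g : u w / adj u w}.
  move=> [i a] [j b]; rewrite [RHS]/= /clique_ext_adj /= xpair_eqE /g /=.
  have [->|ij] /= := eqVneq i j.
    rewrite -/(a == b); have [->|ab] := eqVneq a b; first by rewrite adj_irrefl.
    have: (a == ord0) != (b == ord0) by apply: contra_neq ab; apply: ord2.
    case: (a == ord0); case: (b == ord0) => //= _; first exact: adj_tw.
    by rewrite adj_sym adj_tw.
  have /andP[vij _] := vneq i j ij; rewrite -vadj.
  have vji : v j != v i by rewrite eq_sym.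
  case: (a == ord0); case: (b == ord0) => //.
  - by rewrite adj_sym adj_twl // adj_sym.
  - by rewrite adj_twl.
  - rewrite adj_twl ?(inj_eq (can_inj twK)) 1?eq_sym //.
    by rewrite adj_sym adj_twl // adj_sym.
(* Every vertex is within distance two of [x], and the neighbourhoods of [x], [c], [d] are known
   from [pentagon_nbr]. *)
have gsurj y : exists t, g t = y.
  have gv (i : 'I_5) : exists t, g t = v i by exists (i, ord0).
  have gt (i : 'I_5) : exists t, g t = tw (v i) by exists (i, ord_max).
  have s5 i (hi : i < 5) : exists t, g t = nth x s i.
    exact: (gv (Ordinal hi)).
  have t5 i (hi : i < 5) : exists t, g t = tw (nth x s i).
    exact: (gt (Ordinal hi)).
  have [->|yx] := eqVneq y x; first exact: (s5 0).
  have [xy|nxy] := boolP (adj x y).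
    have := pentagon_nbr k5 xc xd cd ncd xy; rewrite !inE.
    case/or4P => [/eqP->|/eqP->|/eqP->|/orP[]/eqP->].
    - exact: (t5 0). - exact: (s5 1). - exact: (t5 1). - exact: (s5 4).
    - exact: (t5 4).
  have fromc : adj c y -> exists t, g t = y.
    move=> cy; have := pentagon_nbr k5 cx ce xe nxe cy; rewrite !inE.
    case/or4P => [/eqP E|/eqP E|/eqP E|/orP[]/eqP->].
    - by case/negP: nxy; rewrite E adj_twr.
    - by rewrite E eqxx in yx.
    - by case/negP: nxy; rewrite E adj_tw.
    - exact: (s5 2).
    - exact: (t5 2).
  have fromd : adj d y -> exists t, g t = y.
    move=> dy; have := pentagon_nbr k5 dx dh xh nxh dy; rewrite !inE.
    case/or4P => [/eqP E|/eqP E|/eqP E|/orP[]/eqP->].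
    - by case/negP: nxy; rewrite E adj_twr.
    - by rewrite E eqxx in yx.
    - by case/negP: nxy; rewrite E adj_tw.
    - exact: (s5 3).
    - exact: (t5 3).
  have xy : x != y by gr.
  have [w /andP[xw yw]] := common_exists xy nxy.
  have := pentagon_nbr k5 xc xd cd ncd xw; rewrite !inE.
  have twy z : adj x z -> z != tw x -> w = tw z -> adj z y.
    by move=> xz zt E; rewrite -adj_twl -?E; gr.
  case/or4P => [/eqP E|/eqP E|/eqP E|/orP[]/eqP E].
  - by case/negP: (twxN y nxy yx); rewrite -E; gr.
  - by apply: fromc; rewrite -E; gr.
  - by apply: fromc; apply: twy.
  - by apply: fromd; rewrite -E; gr.
  - by apply: fromd; apply: twy.
have gsurjb y : exists t, g t == y by have [t <-] := gsurj y; exists t.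
pose f y := xchoose (gsurjb y).
have fK y : g (f y) = y by apply/eqP/(xchooseP (gsurjb y)).
have gK t : f (g t) = t by apply: ginj; rewrite fK.
exists f; first by exists g.
by move=> y z; rewrite -gadj !fK.
Qed.
End Twins.

(** * The dichotomy on twins and the two classifications *)

Lemma no_twins_or_twins : (forall x y, adj x y -> lam x y < k.-1) \/
  exists tw, forall x, twin x (tw x).
Proof.
have [/existsP[x /existsP[u xu]]|] := boolP [exists x, exists u, twin x u].
  right; exists (fun y => xchoose (twin_all y xu)) => y.
  exact: (xchooseP (twin_all y xu)).
rewrite negb_exists => /forallP nt; left=> x y xy.
have := nt x; rewrite negb_exists => /forallP/(_ y).
by rewrite /twin xy /=; have := lam_ltk xy; clear; lia.
Qed.

Lemma classification_large_sum x1 y1 : adj x1 y1 ->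
  ~ (exists m, forall x y, adj x y -> lam x y = m) -> 3 * k <= 4 * L ->
  (exists p q, [/\ q < p, 2 <= q, p + q = k + 2, isomorphic G (grid p q)
                 & L + 2 = k])
  \/ isomorphic G (clique_extension 2 (cycle_graph 5)).
Proof.
move=> xy nsrg kL; have [ntw|[tw twP]] := no_twins_or_twins.
  by left; apply: (grid_of_no_twins xy ntw nsrg); left.
by right; apply: (pentagon_of_twins twP kL x1).
Qed.

Lemma classification_large_valency x1 y1 : adj x1 y1 ->
  ~ (exists m, forall x y, adj x y -> lam x y = m) -> large_valency ->
  exists p q, [/\ q < p, 2 <= q, p + q = k + 2, isomorphic G (grid p q)
                & L + 2 = k].
Proof.
move=> xy nsrg lv; have [ntw|[tw twP]] := no_twins_or_twins.
  by apply: (grid_of_no_twins xy ntw nsrg); right.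
by case: (twins_large_valency twP x1 lv).
Qed.
End LocalStructure.

(** * Spectrum *)

Local Open Scope ring_scope.

Section SymmetricMatrices.
Variables (R : rcfType) (n : nat) (A : 'M[R]_n).
Hypothesis symA : A^T = A.
Local Open Scope sesquilinear_scope.
Local Notation toC := (map_mx (real_complex R)).

(** Over [R[i]] the matrix is Hermitian, so it is unitarily diagonalizable with a real diagonal. *)
Lemma symmetric_spectral : exists (P : 'M[R[i]]_n) (d : 'rV[R]_n),
  [/\ P \is unitarymx, toC A = P ^t* *m diag_mx (toC d) *m P
    & forall j, eigenvalue A (d 0 j)].
Proof.
have herm : toC A \is hermsymmx.
  apply: realsym_hermsym.
    apply/is_hermitianmxP; rewrite expr0 scale1r map_mx_id //.
    by apply/matrixP => i j; rewrite -[in LHS]symA !mxE.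
  by apply/mxOverP => i j; rewrite mxE complex_real.
have unP := spectral_unitarymx (toC A).
have /orthomx_spectralP := hermitian_normalmx herm.
have /mxOverP dreal := hermitian_spectral_diag_real herm.
set P := spectralmx _ in unP *; set D := spectral_diag _ in dreal * => AE.
pose d : 'rV[R]_n := \row_j complex.Re (D 0 j).
have dE : toC d = D by apply/matrixP => i j; rewrite ord1 !mxE RRe_real.
exists P, d; split=> //; first by rewrite dE -invmx_unitary.
move=> j; rewrite -(eigenvalue_map (real_complex R)); apply/eigenvalueP.
have unitP : P \in unitmx := unitarymx_unit unP.
(* The rows of [P] are left eigenvectors, non-zero because [P] is invertible. *)
exists (row j P).
  rewrite AE -row_mul !mulmxA mulmxV // mul1mx row_mul row_diag_mx.
  by rewrite -scalemxAl -rowE -dE !mxE.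
apply/eqP => rj0; have := congr1 (mulmx^~ (invmx P)) rj0.
rewrite -row_mul mulmxV // mul0mx => /matrixP/(_ 0 j); rewrite !mxE eqxx.
by move/eqP; rewrite oner_eq0.
Qed.

Lemma symmetric_annihilator (a b c e : R) :
  (forall x, eigenvalue A x -> x \in [:: a; b; c; e]) ->
  (A - a%:M) *m (A - b%:M) *m (A - c%:M) *m (A - e%:M) = 0.
Proof.
move=> spec; have [P [d [unP AE dE]]] := symmetric_spectral.
have PP : P *m P ^t* = 1%:M by apply/unitarymxP.
have PP' : P ^t* *m P = 1%:M.
  by rewrite -invmx_unitary // mulVmx // unitarymx_unit.
have sub x : toC (A - x%:M) = P ^t* *m diag_mx (toC (d - const_mx x)) *m P.
  rewrite map_mxB map_scalar_mx AE map_mxB linearB /= mulmxBr mulmxBl.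
  by rewrite map_const_mx diag_const_mx mul_mx_scalar -scalemxAl PP' scalemx1.
have conjM (D1 D2 : 'M[R[i]]_n) : P ^t* *m D1 *m P *m (P ^t* *m D2 *m P) =
    P ^t* *m (D1 *m D2) *m P.
  by rewrite !mulmxA -(mulmxA _ P (P ^t*)) PP mulmx1.
apply: (map_mx_inj (f := real_complex R)); rewrite map_mx0 !map_mxM !sub !conjM.
have zero x j : d 0 j = x -> toC (d - const_mx x) 0 j = 0.
  by move=> dx; rewrite 3!mxE dx mxE subrr rmorph0.
rewrite !mulmx_diag; move: (zero a) (zero b) (zero c) (zero e).
move: (toC (d - const_mx a)) (toC (d - const_mx b)) => ra rb.
move: (toC (d - const_mx c)) (toC (d - const_mx e)) => rc re za zb zc ze.
set r := \row_j _; suff -> : r = 0 by rewrite linear0 mulmx0 mul0mx.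
apply/rowP => j; rewrite 3!mxE [RHS]mxE.
have := spec _ (dE j); rewrite !inE => /or4P[] /eqP dj.
- by rewrite za // !mul0r.
- by rewrite zb // mulr0 !mul0r.
- by rewrite zc // mulr0 mul0r.
- by rewrite ze // mulr0.
Qed.

(** In the coordinates w of [v] along the rows of [P], both sides are sums of the squared moduli of
    w_j, weighted by t and by the eigenvalues. *)
Lemma symmetric_rayleigh (t : R) : (forall x, eigenvalue A x -> t <= x) ->
  forall v : 'rV[R]_n, t * (v *m v^T) 0 0 <= (v *m A *m v^T) 0 0.
Proof.
move=> spec v; have [P [d [unP AE dE]]] := symmetric_spectral.
have PP' : P ^t* *m P = 1%:M.
  by rewrite -invmx_unitary // mulVmx // unitarymx_unit.
pose w := toC v *m P ^t*.
have vE : toC v^T = (toC v) ^t*.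
  apply/matrixP => i j; rewrite !mxE conj_Creal //.
  by rewrite complex_real.
have wE : w ^t* = P *m toC v^T by rewrite vE trmx_mul map_mxM trmxCK.
have e1 : toC (v *m v^T) = w *m w ^t*.
  by rewrite wE map_mxM /w mulmxA -(mulmxA _ _ P) PP' mulmx1.
have e2 : toC (v *m A *m v^T) = w *m diag_mx (toC d) *m w ^t*.
  by rewrite wE !map_mxM AE /w !mulmxA.
have wC j : (w ^t*) j 0 = (w 0 j)^* by rewrite 2!mxE.
have s1 : ((v *m v^T) 0 0)%:C%C = \sum_j w 0 j * (w 0 j)^*.
  have := congr1 (fun M : 'M_1 => M 0 0) e1; rewrite mxE => ->.
  by rewrite mxE; apply: eq_bigr => j _; rewrite wC.
have s2 : ((v *m A *m v^T) 0 0)%:C%C =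
    \sum_j (d 0 j)%:C%C * (w 0 j * (w 0 j)^*).
  have := congr1 (fun M : 'M_1 => M 0 0) e2; rewrite mxE => ->.
  rewrite mxE; apply: eq_bigr => j _; rewrite wC mul_mx_diag mxE.
  by rewrite [toC d 0 j]mxE mulrCA mulrA.
rewrite -lecR rmorphM /= s1 s2 mulr_sumr; apply: ler_sum => j _.
by rewrite ler_wpM2r ?mul_conjC_ge0 // lecR spec.
Qed.
End SymmetricMatrices.

(** * What the eigenvalues say about [lam] *)

Section AdjacencyMatrix.
Variables (R : rcfType) (G : sgraph) (k : nat).
Hypothesis regG : regular G k.
Hypothesis muG : forall x y : G, x != y -> ~~ adj x y -> #|cnbr x y| = 2%N.
Implicit Types x y z u v : G.
Local Notation A := (adjmx R G).

Lemma sum_enum_val (F : G -> R) :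
  \sum_(i < #|G|) F (enum_val i) = \sum_x F x.
Proof. by rewrite -(big_enum_val F). Qed.

Lemma sum_nbr (F : G -> R) y :
  \sum_z (adj y z)%:R * F z = \sum_(z in nbr y) F z.
Proof.
rewrite [RHS]big_mkcond; apply: eq_bigr => z _; rewrite in_nbr.
by case: (adj y z); rewrite (mul1r, mul0r).
Qed.

Lemma adjmx_sym : A^T = A.
Proof. by apply/matrixP => i j; rewrite !mxE adj_sym. Qed.

Lemma adjmx_rank x y : A (enum_rank x) (enum_rank y) = (adj x y)%:R.
Proof. by rewrite mxE !enum_rankK. Qed.

Lemma mul_adjmx m (M : 'M[R]_(#|G|, m)) x j :
  (A *m M) (enum_rank x) j = \sum_(z in nbr x) M (enum_rank z) j.
Proof.
rewrite mxE -sum_nbr -sum_enum_val; apply: eq_bigr => i _.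
by rewrite mxE enum_rankK enum_valK.
Qed.

Lemma mul_mx_adj m (M : 'M[R]_(m, #|G|)) i y :
  (M *m A) i (enum_rank y) = \sum_(z in nbr y) M i (enum_rank z).
Proof.
rewrite mxE -sum_nbr -sum_enum_val; apply: eq_bigr => j _.
by rewrite mxE enum_rankK enum_valK mulrC adj_sym.
Qed.

Lemma adjmx2 x y : (A *m A) (enum_rank x) (enum_rank y) = (lam x y)%:R.
Proof.
rewrite mul_adjmx /lam -sum1_card natr_sum big_mkcond [RHS]big_mkcond /=.
apply: eq_bigr => z _; rewrite adjmx_rank in_nbr in_cnbr (adj_sym z).
by case: (adj x z); case: (adj y z).
Qed.

Lemma sum_nbr_const (c : R) x : \sum_(z in nbr x) c = k%:R * c.
Proof. by rewrite sumr_const [#|nbr x|]regG mulr_natl. Qed.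

(** Maximum principle: at a vertex where [f] is maximal, all neighbours attain the maximum, and two
    such steps reach every vertex. *)
Lemma harmonic_const (f : G -> R) :
  (forall y, \sum_(z in nbr y) f z = k%:R * f y) -> forall x y, f x = f y.
Proof.
move=> harm x y.
have [m _ mmax] := Order.TotalTheory.arg_maxP (i0 := x) f (isT : predT x).
have nbr_max a : (forall z, f z <= f a) -> forall z, adj a z -> f z = f a.
  move=> amax z az; apply/esym/eqP; rewrite -subr_eq0; apply/eqP.
  have sum0 : \sum_(z in nbr a) (f a - f z) = 0.
    by rewrite sumrB harm sum_nbr_const subrr.
  have := psumr_eq0P (fun z _ => _) sum0; apply; last by rewrite in_nbr.
  by move=> t; rewrite subr_ge0.
have all_max a : f a = f m.
  have mm z : f z <= f m by apply: mmax.
  have [->//|am] := eqVneq a m; have [ma|nma] := boolP (adj m a).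
    exact: nbr_max.
  have ma : m != a by rewrite eq_sym.
  have [w /andP[mw aw]] := common_exists muG ma nma.
  have fw := nbr_max m mm w mw.
  by rewrite (nbr_max w) ?fw // adj_sym.
by rewrite !all_max.
Qed.

Lemma mx_cubic_expand (t1 t2 t3 : R) :
  (A - t1%:M) *m (A - t2%:M) *m (A - t3%:M) =
  A *m (A *m A) - (t1 + t2 + t3) *: (A *m A)
  + (t1 * t2 + t1 * t3 + t2 * t3) *: A - (t1 * t2 * t3)%:M.
Proof.
have E (t : R) (M : 'M[R]_#|G|) : (A - t%:M) *m M = A *m M - t *: M.
  by rewrite mulmxBl mul_scalar_mx.
rewrite -mulmxA !E 2!mulmxBr -[A *m (t2 *: _)]scalemxAr 2!mulmxBr !mul_mx_scalar.
rewrite -scalemxAr.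
move: (A *m A) => A2.
by apply/matrixP => i j; rewrite !mxE; case: (i == j); rewrite ?mulr0n; ring.
Qed.

Section Spectrum.
Variables t1 t2 t3 : R.
Hypothesis specG : forall t : R,
  eigenvalue A t -> t \in [:: k%:R; t1; t2; t3].

(** The product M satisfies AM = MA = kM, so its rows and columns are constant by [harmonic_const].
    Applying M to the all-one vector gives the common entry. *)
Lemma mx_cubic_const x y :
  ((A - t1%:M) *m (A - t2%:M) *m (A - t3%:M)) (enum_rank x) (enum_rank y) =
  (k%:R - t1) * (k%:R - t2) * (k%:R - t3) / #|G|%:R.
Proof.
have rowsum (t c : R) : (A - t%:M) *m const_mx c =
    const_mx ((k%:R - t) * c) :> 'cV[R]_#|G|.
  apply/colP => i; rewrite mulmxBl mul_scalar_mx -(enum_valK i) mxE mul_adjmx.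
  under eq_bigr do rewrite mxE.
  by rewrite sum_nbr_const !mxE mulrBl.
set M := _ *m _.
have AM : A *m M = k%:R *: M.
  have := symmetric_annihilator adjmx_sym specG.
  by rewrite -!mulmxA (mulmxA (A - t1%:M)) -/M mulmxBl mul_scalar_mx => /subr0_eq.
(* The annihilator depends on the spectrum only as a set, so the factor for k may also come last. *)
have MA : M *m A = k%:R *: M.
  have := @symmetric_annihilator R _ A adjmx_sym t1 t2 t3 k%:R.
  rewrite -/M mulmxBr mul_mx_scalar => h; apply/subr0_eq/h => t /specG.
  by rewrite !inE => /or4P[] ->; rewrite ?orbT.
have cst x' y' : M (enum_rank x') (enum_rank y') = M (enum_rank x) (enum_rank y).
  transitivity (M (enum_rank x) (enum_rank y')).
    apply: (@harmonic_const (fun z => M (enum_rank z) (enum_rank y'))) => z.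
    by rewrite -mul_adjmx AM mxE.
  apply: (@harmonic_const (fun z => M (enum_rank x) (enum_rank z))) => z.
  by rewrite -mul_mx_adj MA mxE.
have sumM : M *m (const_mx 1 : 'cV[R]_#|G|) =
    const_mx ((k%:R - t1) * (k%:R - t2) * (k%:R - t3)).
  by rewrite /M -!mulmxA !rowsum mulr1 !mulrA.
have n0 : #|G|%:R != 0 :> R.
  by rewrite pnatr_eq0 -lt0n; apply/card_gt0P; exists x.
apply: (mulIf n0); rewrite mulfVK //.
have <- : (M *m (const_mx 1 : 'cV[R]_#|G|)) (enum_rank x) 0 =
    (k%:R - t1) * (k%:R - t2) * (k%:R - t3) by rewrite sumM mxE.
rewrite [RHS]mxE (eq_bigr (fun _ => M (enum_rank x) (enum_rank y))) => [|i _].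
  by rewrite sumr_const card_ord mulr_natr.
by rewrite [const_mx _ _ _]mxE mulr1 -(enum_valK i) cst.
Qed.

(** Compare the (x, y) entries of the cubic: the cube of A is given by [walk3_nonadj], the square
    contributes 2, and A and the identity contribute 0. *)
Lemma lam_sum x y u v : x != y -> ~~ adj x y -> u != v ->
  adj x u -> adj y u -> adj x v -> adj y v ->
  (lam y u + lam y v)%:R = 2 * (t1 + t2 + t3)
    + (k%:R - t1) * (k%:R - t2) * (k%:R - t3) / #|G|%:R - 2 * (k%:R - 2).
Proof.
move=> xy nxy uv xu yu xv yv; rewrite -(mx_cubic_const x y) mx_cubic_expand.
have k2 : (2 <= k)%N.
  rewrite -(regG x) -(muG xy nxy); apply/subset_leq_card/subsetP => z.
  by rewrite !inE => /andP[].
set a2 := A *m A; have a2E : a2 (enum_rank x) (enum_rank y) = 2.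
  by rewrite adjmx2 /lam muG.
have a3E : (A *m a2) (enum_rank x) (enum_rank y) =
    (lam y u + lam y v + 2 * (k - 2))%:R.
  rewrite mul_adjmx -(walk3_nonadj regG muG xy nxy uv) // natr_sum.
  by apply: eq_bigr => z _; rewrite adjmx2.
move: (A *m a2) a3E => a3 a3E; clearbody a2.
rewrite !mxE (inj_eq enum_rank_inj) (negPf xy) !enum_rankK (negPf nxy) a2E a3E.
by rewrite !natrD natrB // !mulr0n; ring.
Qed.

End Spectrum.

Lemma eigenfunction (t : R) : eigenvalue A t -> exists2 f : G -> R,
  (exists x, f x != 0) & forall y, \sum_(z in nbr y) f z = t * f y.
Proof.
case/eigenvalueP => v vA v0; exists (fun x => v 0 (enum_rank x)).
  apply/existsP; apply: contraNT v0; rewrite negb_exists => /forallP v0.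
  by apply/eqP/rowP => i; rewrite mxE -(enum_valK i); apply/eqP/negPn/v0.
by move=> y; rewrite -mul_mx_adj vA mxE.
Qed.

Lemma eigenfunction_sum0 (t : R) (f : G -> R) : t != k%:R ->
  (forall y, \sum_(z in nbr y) f z = t * f y) -> \sum_x f x = 0.
Proof.
move=> tk fE; have : t * (\sum_x f x) = k%:R * (\sum_x f x).
  rewrite !mulr_sumr -(eq_bigr _ (fun y _ => fE y)).
  rewrite (exchange_big_dep predT) //=; apply: eq_bigr => z _.
  rewrite -(sum_nbr_const (f z) z); apply: eq_bigl => y.
  by rewrite !in_nbr adj_sym.
by move/eqP; rewrite -subr_eq0 -mulrBl mulf_eq0 subr_eq0 (negPf tk) => /eqP.
Qed.

(** For constant [lam], A^2 = kI + mA + 2(J - I - A), and J kills [f] by [eigenfunction_sum0]. *)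
Lemma edge_regular_eigenvalue (m : nat) (t : R) :
  (forall x y : G, adj x y -> lam x y = m) -> eigenvalue A t -> t != k%:R ->
  t ^+ 2 = (m%:R - 2) * t + (k%:R - 2).
Proof.
move=> lamm /eigenfunction[f [x fx] fE] tk.
have f0 := eigenfunction_sum0 tk fE.
apply: (mulIf fx); rewrite expr2 -mulrA -[t * f x]fE mulr_sumr.
rewrite -(eq_bigr _ (fun y _ => fE y)).
have -> : \sum_(y in nbr x) \sum_(z in nbr y) f z = \sum_z (lam x z)%:R * f z.
  under eq_bigr do rewrite -sum_nbr.
  rewrite exchange_big; apply: eq_bigr => z _; rewrite -mulr_suml; congr (_ * _).
  rewrite /lam -sum1_card natr_sum big_mkcond [RHS]big_mkcond /=.
  apply: eq_bigr => y _; rewrite in_nbr in_cnbr (adj_sym z).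
  by case: (adj x y); case: (adj y z).
have lamE z : (lam x z)%:R * f z = (m%:R - 2) * ((adj x z)%:R * f z)
    + 2 * f z + (k%:R - 2) * ((z == x)%:R * f z) :> R.
  have [->|zx] := eqVneq z x.
    have -> : lam x x = k.
      by rewrite -(regG x); apply: eq_card => w; rewrite !inE andbb.
    by rewrite adj_irrefl /=; ring.
  have [xz|nxz] := boolP (adj x z); first by rewrite lamm //=; ring.
  by rewrite /lam muG 1?eq_sym //=; ring.
under eq_bigr do rewrite lamE.
rewrite !big_split /= -!mulr_sumr sum_nbr f0 fE.
rewrite (bigD1 x) //= eqxx big1 => [|z /negPf->]; last by rewrite mul0r.
by rewrite /=; ring.
Qed.

(** Three distinct numbers cannot be roots of one monic quadratic. *)
Lemma not_edge_regular (t1 t2 t3 : R) : t1 < k%:R -> t2 < t1 -> t3 < t2 ->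
  eigenvalue A t1 -> eigenvalue A t2 -> eigenvalue A t3 ->
  ~ (exists m, forall x y : G, adj x y -> lam x y = m).
Proof.
move=> t1k t21 t32 e1 e2 e3 [m lamm].
have q t := edge_regular_eigenvalue (t := t) lamm.
have q1 := q t1 e1 (negbT (lt_eqF t1k)).
have q2 := q t2 e2 (negbT (lt_eqF (lt_trans t21 t1k))).
have q3 := q t3 e3 (negbT (lt_eqF (lt_trans t32 (lt_trans t21 t1k)))).
have s (a b : R) : b < a -> a ^+ 2 = (m%:R - 2) * a + (k%:R - 2) ->
    b ^+ 2 = (m%:R - 2) * b + (k%:R - 2) -> a + b = m%:R - 2.
  move=> ba qa qb; have ab : a - b != 0 by rewrite subr_eq0 gt_eqF.
  apply: (mulfI ab); rewrite -subr_sqr qa qb; ring.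
by have := s _ _ t21 q1 q2; have := s _ _ t32 q2 q3; lra.
Qed.

(** The test vector [f] satisfies f A f^T = 9s - 6k^2, with s the sum of [lam] at [x], and f f^T =
    9k + k^2. *)
Lemma local_degree_sum x : (forall t : R, eigenvalue A t -> - 3 <= t) ->
  (k * k <= 3 * (\sum_(u in nbr x) lam x u) + 9 * k)%N.
Proof.
move=> spec.
pose f z : R := 3 * (adj x z)%:R - k%:R * (z == x)%:R.
pose v : 'rV[R]_#|G| := \row_i f (enum_val i).
have := symmetric_rayleigh adjmx_sym spec v.
have sumf (h : G -> R) : \sum_z f z * h z = 3 * \sum_(z in nbr x) h z - k%:R * h x.
  rewrite -sum_nbr (mulr_sumr _ _ _ 3).
  rewrite [k%:R * h x](_ : _ = \sum_z k%:R * (z == x)%:R * h z).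
    by rewrite -sumrB; apply: eq_bigr => z _; rewrite /f; ring.
  rewrite (bigD1 x) //= eqxx mulr1 big1 ?addr0 // => z /negPf->.
  by rewrite mulr0 mul0r.
have -> : (v *m v^T) 0 0 = \sum_z f z * f z.
  by rewrite mxE -sum_enum_val; apply: eq_bigr => i _; rewrite !mxE.
pose g y := \sum_(z in nbr y) f z.
have -> : (v *m A *m v^T) 0 0 = \sum_z f z * g z.
  rewrite mxE -sum_enum_val; apply: eq_bigr => i _; rewrite mulrC 2!mxE.
  congr (_ * _); rewrite -[i in LHS]enum_valK mul_mx_adj.
  by apply: eq_bigr => z _; rewrite mxE enum_rankK.
have fx : f x = - k%:R by rewrite /f adj_irrefl eqxx /=; ring.
have fn z : z \in nbr x -> f z = 3.
  by rewrite in_nbr => xz; rewrite /f xz eq_sym (negPf (adj_neq xz)) /=; ring.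
have gx : g x = k%:R * 3 by rewrite /g (eq_bigr _ fn) sum_nbr_const.
have gn z : z \in nbr x -> g z = 3 * (lam x z)%:R - k%:R.
  rewrite in_nbr => xz; rewrite /g sumrB -!mulr_sumr; congr (_ * _ - _).
    rewrite /lam -sum1_card natr_sum big_mkcond [RHS]big_mkcond /=.
    apply: eq_bigr => y _; rewrite in_nbr in_cnbr.
    by case: (adj x y); case: (adj z y).
  rewrite (bigD1 x) /=; last by rewrite in_nbr adj_sym.
  by rewrite eqxx big1 ?addr0 ?mulr1 // => y /andP[_ /negPf->].
rewrite !sumf fx gx (eq_bigr _ fn) (eq_bigr _ gn) sumrB -mulr_sumr !sum_nbr_const.
rewrite -natr_sum -(ler_nat R) natrD !natrM.
move: (\sum_(u in _) _)%N => S; lra.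
Qed.
End AdjacencyMatrix.

Theorem theorem1p2 (R : rcfType) (G : sgraph) (n k : nat) (t1 t2 t3 : R) :
  co_edge_regular G n k 2 ->
  k%:R > t1 -> t1 > t2 -> t2 > t3 ->
  (forall x : R,
     eigenvalue (adjmx R G) x <-> x \in [:: k%:R; t1; t2; t3]) ->
  let l : R := 2 * (t1 + t2 + t3)
               + ((k%:R - t1) * (k%:R - t2) * (k%:R - t3)) / n%:R
               - 2 * (k%:R - 2) in
  (3 / 4 * k%:R <= l ->
     (exists p q : nat,
        [/\ (q < p)%N, (2 <= q)%N, (p + q = k + 2)%N,
            isomorphic G (grid p q) & l = k%:R - 2])
     \/ isomorphic G (clique_extension 2 (cycle_graph 5)))
  /\
  (- 3 <= t3 -> (120 <= k)%N ->
     exists p q : nat,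
       [/\ (q < p)%N, (2 <= q)%N, (p + q = k + 2)%N,
           isomorphic G (grid p q) & l = k%:R - 2]).
Proof.
move=> [cardG regG ncG neG muG] t1k t21 t32 spec l.
have specG t : eigenvalue (adjmx R G) t -> t \in [:: k%:R; t1; t2; t3].
  by move/spec.
have [x0 [y0 [xy0 nxy0]]] : exists x y : G, x != y /\ ~~ adj x y.
  have [/existsP[x /existsP[y /andP[xy nxy]]]|] :=
    boolP [exists x : G, exists y, (x != y) && ~~ adj x y]; first by exists x, y.
  rewrite negb_exists => /forallP cG; case: ncG => x y xy.
  have := cG x; rewrite negb_exists => /forallP/(_ y).
  by rewrite xy /= => /negPn.
have [u0 /andP[xu0 yu0]] := common_exists muG xy0 nxy0.
have [v0 [vu0 xv0 yv0]] := other_common muG xy0 nxy0 xu0 yu0.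
(* [L] is read off one non-adjacent pair. By [lam_sum] every such pair gives the real number [l], so
   [l] is the natural number [L] and the sum is the same everywhere. *)
pose L := (lam y0 u0 + lam y0 v0)%N.
have lamL (x y u v : G) : x != y -> ~~ adj x y -> u != v ->
    adj x u -> adj y u -> adj x v -> adj y v -> (lam y u + lam y v)%:R = l.
  move=> xy nxy uv xu yu xv yv; rewrite /l -cardG.
  exact: (lam_sum regG muG specG xy nxy uv).
have LE : L%:R = l by apply: (lamL x0); rewrite // eq_sym.
have lamG (x y u v : G) : x != y -> ~~ adj x y -> u != v ->
    adj x u -> adj y u -> adj x v -> adj y v -> (lam y u + lam y v)%N = L.
  move=> xy nxy uv xu yu xv yv; apply/eqP; rewrite -(eqr_nat R) LE; apply/eqP.
  exact: (lamL x).
have nsrg : ~ (exists m, forall x y : G, adj x y -> lam x y = m).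
  by apply: (not_edge_regular regG muG t1k t21 t32); apply/spec;
    rewrite !inE eqxx ?orbT.
have fin p q : [/\ (q < p)%N, (2 <= q)%N, (p + q = k + 2)%N,
      isomorphic G (grid p q) & (L + 2 = k)%N] ->
    [/\ (q < p)%N, (2 <= q)%N, (p + q = k + 2)%N,
      isomorphic G (grid p q) & l = k%:R - 2].
  by case=> qp q2 pqk iso Lk; split=> //; rewrite -LE -Lk natrD addrK.
split=> [kl|t3ge k120].
  have kL : (3 * k <= 4 * L)%N.
    by rewrite -(ler_nat R) !natrM LE; lra.
  have [[p [q H]]|] := classification_large_sum regG muG lamG ncG xu0 nsrg kL.
    by left; exists p, q; apply: fin.
  by right.
have lv : large_valency G k.
  split=> // x; apply: (local_degree_sum (R := R) regG) => t /specG.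
  by rewrite !inE => /or4P[] /eqP ->; lra.
have [p [q H]] := classification_large_valency regG muG lamG ncG xu0 nsrg lv.
by exists p, q; apply: fin.
Qed.
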